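(* Let $I$ be either $I_{wf}$ (an ideal on $X=\mathbb{N}^{<\omega}$), $WO(\mathbb{Q})$ (an ideal on $X=\mathbb{Q}$), or $J^\perp$ with $J$ an analytic selective ideal on $X=\mathbb{N}$. For every infinite $A\subseteq X$, the following are equivalent: (i) $I\upharpoonright A$ is isomorphic to an ideal in $\mathcal{B}$. (ii) $I\upharpoonright A$ is Borel.
   Context: An ideal over a countable set $X$ is a family of subsets of $X$ that contains every finite subset of $X$ and is closed under taking subsets and finite unions ($\mathcal{P}(X)$ is allowed). Subsets are identified with characteristic functions, so an ideal is a subset of $2^X$, and ''Borel'', ''analytic'' refer to this subset. Two ideals $I$ on $X$ and $J$ on $Y$ are isomorphic if there is a bijection $f:X\to Y$ such that $A\in I$ iff $f[A]\in J$. $I\upharpoonright K$ is the ideal on $K$ of all subsets of $K$ belonging to $I$. The orthogonal of $I$ is $I^\perp=\{B\subseteq X: A\cap B\text{ is finite for all }A\in I\}$. Direct sum: given finitely or countably many ideals $I_n$ on countably infinite sets $X_n$, take a partition $\{K_n\}$ of $\mathbb{N}$ and an isomorphic copy $I_n'$ of $I_n$ on $K_n$; then $A\in\bigoplus_n I_n$ iff $A\cap K_n\in I_n'$ for all $n$ (well defined up to isomorphism). $\mathcal{B}$ is the smallest collection of ideals on $\mathbb{N}$ (regarded as closed under isomorphism) containing the ideal of finite sets and closed under countable (including finite) direct sums and orthogonal. $\mathbb{N}^{<\omega}$ is the set of finite sequences of natural numbers ordered by extension $\preceq$; a tree is a $\preceq$-downward closed subset, and it is well founded if it has no infinite branch;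 $A\in I_{wf}$ iff $A\subseteq\mathbb{N}^{<\omega}$ is contained in a well founded tree. $WO(\mathbb{Q})$ is the ideal of subsets of $\mathbb{Q}$ that are well founded (well ordered) under the usual order of $\mathbb{Q}$. An ideal $J$ on $\mathbb{N}$ is selective if for every decreasing sequence $(A_n)_{n\in\mathbb{N}}$ of sets with $A_n\notin J$ there is $B\notin J$ such that $B\setminus\{0,\dots,n\}\subseteq A_n$ for all $n\in B$. *)

(* Defs.v *)
From mathcomp Require Import all_boot all_order all_algebra.
From mathcomp Require Import all_classical topology measurable_structure.

Set Implicit Arguments.
Unset Strict Implicit.
Unset Printing Implicit Defensive.

Local Open Scope classical_set_scope.

Definition is_ideal (X : Type) (I : set (set X)) : Prop :=
  [/\ forall A, finite_set A -> I A,
      forall A B, A `<=` B -> I B -> I A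
    & forall A B, I A -> I B -> I (A `|` B)].

Definition ideal_iso (X Y : Type) (I : set (set X)) (J : set (set Y)) : Prop :=
  exists2 f : X -> Y, bijective f & forall A, I A <-> J (f @` A).

(* An ideal on the subset K is a family of subsets of the subtype K; a subset
   of K is turned into a subset of X by taking its image under [set_val]. *)
Definition restrict_to (X : Type) (I : set (set X)) (K : set X) : set (set K) :=
  [set B : set K | I (set_val @` B)].
Arguments restrict_to {X} I K _.

Definition orth (X : Type) (I : set (set X)) : set (set X) :=
  [set B | forall A, I A -> finite_set (A `&` B)].

(* [S] is a direct sum of the ideals [I n], [n \in D]: [K] is the partition
   of nat, [I' n] the copy of [I n] on [K n], and the trace of [A] on [K n] is
   [set_val @^-1` A].  Finite sums are those with [D] finite. *)
Definition direct_sum (D : set nat) (I : nat -> set (set nat))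
    (S : set (set nat)) : Prop :=
  exists (K : nat -> set nat) (I' : forall n, set (set (K n))),
    [/\ partition D K setT,
        forall n, D n -> ideal_iso (I n) (@I' n)
      & S = [set A | forall n, D n -> I' n (set_val @^-1` A)]].

Inductive classB : set (set nat) -> Prop :=
| classB_fin : classB [set A | finite_set A]
| classB_sum (D : set nat) I S :
    (forall n, D n -> classB (I n)) -> direct_sum D I S -> classB S
| classB_orthogonal I : classB I -> classB (orth I)
| classB_iso I J : classB I -> ideal_iso I J -> classB J.

Definition iso_in_B (X : Type) (I : set (set X)) : Prop :=
  exists2 J, classB J & ideal_iso I J.

(* The space 2^X: [bool] carries the discrete topology. *)
Definition two_pow (X : Type) : topologicalType :=
  prod_topology (fun _ : X => bool).

Definition char_set (X : Type) (I : set (set X)) : set (two_pow X) :=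
  [set c : X -> bool | I [set x | c x]].

Definition borel_family (X : Type) (I : set (set X)) : Prop :=
  <<s [set U : set (two_pow X) | open U] >> (char_set I).

(* [nat] carries the discrete topology. *)
Definition baire_space : topologicalType :=
  prod_topology (fun _ : nat => nat).

(* Analytic subsets of a Polish space: the empty set and the continuous images
   of the Baire space. *)
Definition analytic (T : topologicalType) (A : set T) : Prop :=
  A = set0 \/ exists2 f : baire_space -> T, continuous f & range f = A.

Definition analytic_family (X : Type) (I : set (set X)) : Prop :=
  analytic (char_set I).

Definition selective (J : set (set nat)) : Prop :=
  forall A : nat -> set nat,
    (forall n, A n.+1 `<=` A n) -> (forall n, ~ J (A n)) ->
    exists2 B, ~ J B &
      forall n, B n -> B `\` [set k | (k <= n)%N] `<=` A n.

Definition is_tree (T : set (seq nat)) : Prop :=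
  forall s t, prefix s t -> T t -> T s.

(* [mkseq b n] is the initial segment of length [n] of [b]. *)
Definition well_founded_tree (T : set (seq nat)) : Prop :=
  is_tree T /\ ~ (exists b : nat -> nat, forall n, T (mkseq b n)).

Definition Iwf : set (set (seq nat)) :=
  [set A | exists2 T, well_founded_tree T & A `<=` T].

Definition WOQ : set (set rat) :=
  [set A | forall B, B `<=` A -> B !=set0 ->
     exists2 m, B m & forall x, B x -> (m <= x)%R].

(* Main.v *)
Require Import Defs.
From mathcomp Require Import all_boot all_order all_algebra.
From mathcomp Require Import all_classical topology measurable_structure.
Local Open Scope classical_set_scope.

(* An ideal of B and its orthogonal are both Borel, by induction: the orthogonal of a
   direct sum consists of the sets meeting finitely many summands, each in a set of its
   orthogonal; moreover an ideal of B is its own double orthogonal.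

   Conversely, call A bad when the restriction of I to some subset of A is not in B.
   The class B is closed under direct sums and, by duality, under the "finite support"
   sums just described. Hence a bad A splits: in the tree case some node has
   infinitely many bad children above any bad node; in the case of the rationals some
   point has bad sets on both of its sides. In the selective case the bad sets are
   those for which the traces of J are not countably generated, and they split because
   an analytic selective ideal disjoint from an ultrafilter p is contained in a
   countably generated ideal disjoint from p. Iterating a splitting gives a map from
   trees to sets for which the image lies in I exactly when the tree is well
   founded, and the set of well founded trees is not Suslin by diagonalization. *)

(** * Suslin sets and the diagonal argument *)

Definition agree {U : Type} (n : nat) (x y : nat -> U) : Prop :=
  forall i, (i < n)%N -> x i = y i.

Lemma agreeW {U : Type} {n m} {x y : nat -> U} :
  (n <= m)%N -> agree m x y -> agree n x y.
Proof. by move=> nm xy i im; apply/xy/(leq_trans im). Qed.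

(** Topological closedness in the product of $2^{\mathbb{N}}$ and the Baire space, with basic
    neighbourhoods replaced by agreement up to [n]. *)
Definition closed_rel (E : set nat -> (nat -> nat) -> Prop) : Prop :=
  forall T y, (forall n, exists T' y', [/\ E T' y', agree n T T' & agree n y y']) ->
    E T y.

Definition suslin (P : set (set nat)) : Prop :=
  exists2 E, closed_rel E & forall T, P T <-> exists y, E T y.

(** The arbitrary [Q] lets one proof serve a coordinate, its complement and the constant
    families. *)
Lemma suslin_coord (Q : Prop -> Prop) i : suslin [set T : set nat | Q (T i)].
Proof.
exists (fun T _ => Q (T i)) => [T y /(_ i.+1)[T' [y' [ET' TT' _]]]|T].
  by rewrite (TT' i).
by split=> [QT|[]//]; exists id.
Qed.

Lemma suslin_bigcup (P : nat -> set (set nat)) :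
  (forall n, suslin (P n)) -> suslin (\bigcup_n P n).
Proof.
move=> /(_ _)/cid2-/all_sig2[E clE EP].
(* The first entry of the witness names the member of the union; the remaining ones are a witness
   for that member. *)
exists (fun T y => E (y 0) T (fun k => y k.+1)) => [T y cl|T].
  apply: clE => n; have [T' [y' [ET' TT' yy']]] := cl n.+1.
  exists T', (fun k => y' k.+1); split; first by rewrite (yy' 0).
    exact: agreeW TT'.
  by move=> i ?; apply: yy'.
split=> [[n _ /EP[y Ey]]|[y Ey]].
  by exists (fun k => if k is k'.+1 then y k' else n).
by exists (y 0) => //; apply/EP; exists (fun k => y k.+1).
Qed.

Lemma suslin_bigcap (P : nat -> set (set nat)) :
  (forall n, suslin (P n)) -> suslin (\bigcap_n P n).
Proof.
move=> /(_ _)/cid2-/all_sig2[E clE EP].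
exists (fun T y => forall i, E i T (fun k => y (pickle (i, k)))) => [T y cl i|T].
  apply: clE => n.
  (* [N] exceeds the codes of the first [n] entries of the [i]-th of the interleaved witnesses. *)
  pose N := (n + \max_(k < n) (pickle (i, k : nat)).+1)%N.
  have [T' [y' [ET' TT' yy']]] := cl N.
  exists T', (fun k => y' (pickle (i, k))); split=> //.
    exact: agreeW (leq_addr _ _) TT'.
  move=> k kn; apply: yy'; apply: leq_trans (leq_addl _ _).
  exact: (leq_bigmax (Ordinal kn)).
split=> [PT|[y Ey] i _]; last by apply/EP; exists (fun k => y (pickle (i, k))).
have /(_ _)/cid-/all_sig[Y YE] i : exists y, E i T y by apply/EP/PT.
exists (fun m => if unpickle m is Some (i, k) then Y i k else 0) => i.
by under eq_fun do rewrite pickleK.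
Qed.

(** The easy half of Suslin's theorem: these families are closed under complements and countable
    unions, hence contain preimages of Borel families ([bisuslin_borel]). *)
Definition bisuslin (P : set (set nat)) : Prop := suslin P /\ suslin (~` P).

Lemma bisuslin_coord i : bisuslin [set T : set nat | T i].
Proof. by split; [apply: (suslin_coord id)|apply: (suslin_coord not)]. Qed.

Lemma bisuslinC P : bisuslin P -> bisuslin (~` P).
Proof. by rewrite /bisuslin setCK => -[]. Qed.

Lemma bisuslin_bigcup (P : nat -> set (set nat)) :
  (forall n, bisuslin (P n)) -> bisuslin (\bigcup_n P n).
Proof.
move=> PP; split; first by apply: suslin_bigcup => n; case: (PP n).
by rewrite setC_bigcup; apply: suslin_bigcap => n; case: (PP n).
Qed.

Lemma bisuslin_const (Q : Prop) : bisuslin [set _ : set nat | Q].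
Proof.
by split; [apply: (suslin_coord (fun=> Q) 0)|apply: (suslin_coord (fun=> ~ Q) 0)].
Qed.

Lemma bisuslin_ex (U : countType) (P : U -> set (set nat)) :
  (forall u, bisuslin (P u)) -> bisuslin [set T | exists u, P u T].
Proof.
move=> PP.
have -> : [set T | exists u, P u T] =
    \bigcup_n (if unpickle n is Some u then P u else set0).
  apply/seteqP; split=> [T [u Pu]|T [n _]]; first by exists (pickle u); rewrite ?pickleK.
  by case: unpickle => // u Pu; exists u.
apply: bisuslin_bigcup => n; case: unpickle => [u|]; first exact: PP.
exact: bisuslin_const.
Qed.

Lemma bisuslin_all (U : countType) (P : U -> set (set nat)) :
  (forall u, bisuslin (P u)) -> bisuslin [set T | forall u, P u T].
Proof.
move=> PP.
have -> : [set T | forall u, P u T] = ~` [set T | exists u, (~` P u) T].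
  apply/seteqP; split=> [T PT [u]|T nPT u]; first exact.
  by apply: contrapT => nP; apply: nPT; exists u.
by apply/bisuslinC/bisuslin_ex => u; apply: bisuslinC.
Qed.

Lemma bisuslinI P Q : bisuslin P -> bisuslin Q -> bisuslin (P `&` Q).
Proof.
move=> bP bQ.
have -> : P `&` Q = [set T | forall b : bool, (if b then P else Q) T].
  by apply/seteqP; split=> [T [? ?] []|T PQ]//; split; [apply: (PQ true)|apply: (PQ false)].
by apply: bisuslin_all => -[].
Qed.

Lemma bisuslin_implyl (q : Prop) P : bisuslin P -> bisuslin [set T | q -> P T].
Proof.
move=> bP; have [hq|nq] := pselect q.
  by have -> : [set T | q -> P T] = P by apply/seteqP; split=> [T /(_ hq)|T PT].
have -> : [set T | q -> P T] = [set _ | True] by apply/seteqP; split=> // T _ /nq.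
exact: bisuslin_const.
Qed.

Lemma mkseq_take (b : nat -> nat) m n : (m <= n)%N -> take m (mkseq b n) = mkseq b m.
Proof. by move=> mn; rewrite /mkseq -map_take take_iota (minn_idPl mn). Qed.

Definition bits (R : set nat) n : seq bool := mkseq (fun i => `[< R i >]) n.

Lemma bits_agree n (R R' : set nat) : bits R n = bits R' n <-> agree n R R'.
Proof.
split=> [e i im|RR']; last first.
  apply: (@eq_from_nth _ false); rewrite !size_mkseq// => i im.
  by rewrite !nth_mkseq// RR'.
move/(congr1 (nth false ^~ i)): e; rewrite !nth_mkseq// => e.
by rewrite -[R i]asboolE e// asboolE.
Qed.

Lemma mkseq_agree n (y y' : nat -> nat) : mkseq y n = mkseq y' n <-> agree n y y'.
Proof.
split=> [e i im|yy']; last first.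
  apply: (@eq_from_nth _ 0); rewrite !size_mkseq// => i im.
  by rewrite !nth_mkseq// yy'.
by move/(congr1 (nth 0 ^~ i)): e; rewrite !nth_mkseq.
Qed.

(* The tree of attempts to show that [R], read as a code for a Suslin set,
   belongs to the set it codes. *)
Definition self_tree (R : set nat) : set (seq nat) :=
  [set t | forall m, (m <= size t)%N -> R (pickle (bits R m, take m t))].

Lemma self_tree_tree R : is_tree (self_tree R).
Proof.
move=> s t /prefixP[u ->] tt m ms; have := tt m; rewrite size_cat.
by rewrite takel_cat//; apply; apply: leq_trans (leq_addr _ _).
Qed.

Lemma self_tree_branch R b : (forall n, self_tree R (mkseq b n)) <->
  forall m, R (pickle (bits R m, mkseq b m)).
Proof.
split=> [tb m|Rb n m]; last by rewrite size_mkseq => mn; rewrite mkseq_take.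
by have := tb m m; rewrite size_mkseq mkseq_take//; apply.
Qed.

(** A Suslin family with relation [E] is coded by the set [R0] of codes of finite pieces of pairs in
    [E]. As [E] is closed, [self_tree R0] has a branch exactly when [R0] belongs to the family,
    while the family was to consist of the sets whose tree has no branch. *)
Lemma not_suslin_self_tree :
  ~ suslin [set R | ~ exists b, forall n, self_tree R (mkseq b n)].
Proof.
move=> [E clE EP].
pose R0 := [set c | exists T y n, E T y /\ c = pickle (bits T n, mkseq y n)].
have key : (exists y, E R0 y) <-> exists b, forall n, self_tree R0 (mkseq b n).
  split=> -[y]; first by move=> Ey; exists y; apply/self_tree_branch => m; exists R0, y, m.
  move/self_tree_branch => Ry; exists y; apply: clE => n.
  have [T [y' [m [ETy /(pcan_inj pickleK)[eb es]]]]] := Ry n.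
  have mn : n = m by have := congr1 size es; rewrite !size_mkseq.
  exists T, y'; split=> //; first by apply/bits_agree; rewrite mn -eb mn.
  by apply/mkseq_agree; rewrite es mn.
have /= := EP R0; tauto.
Qed.

Lemma bisuslin_self_tree t : bisuslin [set R | self_tree R t].
Proof.
apply: bisuslin_all => m.
apply: (@bisuslin_implyl _ [set R : set nat | R (pickle (bits R m, take m t))]).
(* The tested coordinate depends on [R] through [bits R m]; quantifying over the countably many
   values of [bits R m] fixes it. *)
have -> : [set R : set nat | R (pickle (bits R m, take m t))] =
  [set R | exists s : seq bool, (bits R m = s) /\ R (pickle (s, take m t))].
  by apply/seteqP; split=> [R /= ?|R /= [s [<-]]]//; exists (bits R m).
apply: bisuslin_ex => s.
apply: (@bisuslinI [set R | bits R m = s]); last exact: bisuslin_coord.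
have -> : [set R : set nat | bits R m = s] =
  [set R | size s = m /\ forall i, (i < m)%N -> R i <-> nth false s i].
  apply/seteqP; split=> R /=.
    move=> <-; rewrite size_mkseq; split=> // i im; rewrite nth_mkseq//.
    by split=> /asboolP.
  move=> [sm sR]; apply: (@eq_from_nth _ false); rewrite size_mkseq// => i im.
  by rewrite nth_mkseq//; apply/asboolP/idP => /sR; apply.
apply: (@bisuslinI [set _ | size s = m]); first exact: bisuslin_const.
apply: bisuslin_all => i.
apply: (@bisuslin_implyl _ [set R : set nat | R i <-> nth false s i]); case: nth.
  have -> : [set R : set nat | R i <-> true] = [set R | R i].
    by apply/seteqP; split=> R /= => [[_]|Ri]; [apply|split].
  exact: bisuslin_coord.
have -> : [set R : set nat | R i <-> false] = ~` [set R | R i].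
  apply/seteqP; split=> [R /= [nR _] /nR//|R /= nR].
  by split=> // /nR.
exact/bisuslinC/bisuslin_coord.
Qed.

Lemma prod_discrete_nbhs {X : eqType} {D : discreteTopologicalType}
    (x : prod_topology (fun _ : X => D)) (U : set (prod_topology (fun _ : X => D))) :
  nbhs x U -> exists s : seq X, forall y, {in s, forall i, y i = x i} -> U y.
Proof.
pose F : set_system (prod_topology (fun _ : X => D)) :=
  [set V | exists s : seq X, forall y, {in s, forall i, y i = x i} -> V y].
have FF : Filter F.
  split; first by exists [::].
    move=> V W [s sV] [t tW]; exists (s ++ t) => y yx.
    by split; [apply: sV|apply: tW] => i ii; apply: yx; rewrite mem_cat ii ?orbT.
  by move=> V W VW [s sV]; exists s => y /sV/VW.
(* Convergence in the product is checked coordinatewise, where a cylinder with a single constraint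
   suffices. *)
have : F --> x.
  apply/cvg_sup => i A.
  rewrite nbhsE => -[_ [[B _ <-] /= Bx] BA]; exists [:: i] => y yx; apply: BA.
  by rewrite /= yx ?mem_head.
by apply.
Qed.

Lemma tree_branch (P : seq nat -> Prop) :
  P [::] -> (forall u, P u -> exists n, P (rcons u n)) ->
  exists b : nat -> nat, forall n, P (mkseq b n).
Proof.
move=> P0 Pn.
have /(_ _)/cid-/all_sig[g gP] u : exists n, P u -> P (rcons u n).
  by have [/Pn[n ?]|?] := pselect (P u); [exists n|exists 0].
pose us := fix us k := if k is k'.+1 then rcons (us k') (g (us k')) else [::].
exists (fun k => g (us k)).
suff usE n : mkseq (fun k => g (us k)) n = us n.
  by move=> n; rewrite usE; elim: n => //= n /gP.
by elim: n => // n IH; rewrite mkseqS IH.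
Qed.

(** The sets of points whose preimage under [chi] is bi-Suslin form a sigma-algebra, and it contains
    the open sets. *)
Lemma bisuslin_borel (X : countType) (h : set nat -> set X) (I : set (set X)) :
  (forall x, bisuslin [set R | h R x]) -> borel_family I ->
  bisuslin [set R | I (h R)].
Proof.
move=> hx; pose chi R : two_pow X := fun x => `[< h R x >].
have hxb x b : bisuslin [set R | chi R x = b].
  have -> : [set R | chi R x = b] = if b then [set R | h R x] else ~` [set R | h R x].
    apply/seteqP; rewrite /chi; case: b; split=> R /=.
    - by move/asboolP.
    - by move/asboolP.
    - by move/asboolP.
    - by move=> nh; apply/asboolP.
  by case: b; [|apply: bisuslinC].
move=> /(_ [set V | bisuslin [set R | V (chi R)]]) /= bI.
suff: bisuslin [set R | char_set I (chi R)].
  congr bisuslin; apply: eq_set => R; rewrite /char_set/=; congr (I _).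
  by apply/seteqP; split=> x /=; rewrite /chi => /asboolP.
apply: bI; split; first split => /=.
- exact: bisuslin_const.
- move=> V bV; have -> : [set R | (setT `\` V) (chi R)] = ~` [set R | V (chi R)].
    by apply/seteqP; split=> R => [[]//|]; split.
  exact: bisuslinC.
- move=> V bV; have -> : [set R | (\bigcup_k V k) (chi R)] =
      \bigcup_k [set R | V k (chi R)] by apply/seteqP; split.
  exact: bisuslin_bigcup.
move=> V /= oV.
(* An open set is the union of the cylinders inside it; there are countably many, each given by a
   finite list of coordinates with prescribed values. *)
have -> : [set R | V (chi R)] = [set R | exists s : seq (X * bool),
    (forall c : two_pow X, (forall p, p \in s -> c p.1 = p.2) -> V c) /\
    forall p, p \in s -> chi R p.1 = p.2].
  apply/seteqP; split=> R /=; last by move=> [s [sV sR]]; apply: sV.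
  move=> VR; have [s sV] : exists s : seq X,
      forall y : two_pow X, {in s, forall i, y i = chi R i} -> V y.
    by apply: prod_discrete_nbhs; apply: open_nbhs_nbhs.
  exists [seq (x, chi R x) | x <- s]; split; last by move=> _ /mapP[x _ ->].
  move=> c cR; apply: sV => x xs.
  by apply: (cR (x, chi R x)); apply/mapP; exists x.
apply: bisuslin_ex => s.
apply: (@bisuslinI [set R | forall c : two_pow X, (forall p, p \in s -> c p.1 = p.2) -> V c]).
  exact: bisuslin_const.
apply: bisuslin_all => p.
exact: (@bisuslin_implyl _ [set R | chi R p.1 = p.2]).
Qed.

(** Otherwise the sets [R] with [self_tree R] well founded would form the preimage of a Borel family
    under a map with bi-Suslin coordinates, hence a Suslin family. *)
Lemma wf_reduction_not_borel (X : countType) (I : set (set X)) (phi : seq nat -> X) :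
  (forall T, is_tree T ->
     I (phi @` T) <-> ~ exists b, forall n, T (mkseq b n)) ->
  ~ borel_family I.
Proof.
move=> Iphi bI; apply: not_suslin_self_tree.
have -> : [set R | ~ exists b, forall n, self_tree R (mkseq b n)] =
    [set R | I (phi @` self_tree R)].
  by apply/seteqP; split=> R /= /Iphi; apply=> //; apply: self_tree_tree.
apply: (bisuslin_borel _ (fun R => phi @` self_tree R) I _ bI).1 => x.
have -> : [set R | (phi @` self_tree R) x] =
    [set R | exists t, phi t = x /\ self_tree R t].
  by apply/seteqP; split=> R /= => [[t Rt <-]|[t [<- Rt]]]; exists t.
apply: bisuslin_ex => t.
by apply: (@bisuslinI [set _ | phi t = x]); [apply: bisuslin_const|apply: bisuslin_self_tree].
Qed.

(* Transfers the non-Borelness of the set of well founded trees: the tree [T] is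
   sent to the set of points attached to the configurations reached along [T]. *)
Lemma scheme_not_borel (X : countType) (I : set (set X)) (A : set X)
    (C : Type) (c0 : C) (pt : C -> X) (E : C -> set X) (next : C -> nat -> C) :
  is_ideal I ->
  (forall c, A (pt c)) -> (forall c, E c (pt c)) ->
  (forall c n, E (next c n) `<=` E c) ->
  (forall c (S : nat -> set X), (forall n, S n `<=` E (next c n)) ->
    (forall n, I (S n)) -> I (\bigcup_n S n)) ->
  (forall c : nat -> C, (forall k, exists n, c k.+1 = next (c k) n) ->
    ~ I (range (pt \o c))) ->
  ~ borel_family (restrict_to I A).
Proof.
move=> [Ifin Isub IU] Apt Ept Enext Icup Ibr.
pose conf u := foldl next c0 u.
have Econf u v : E (conf (u ++ v)) `<=` E (conf u).
  elim/last_ind: v => [|v n IH]; first by rewrite cats0.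
  rewrite -rcons_cat /conf foldl_rcons; exact: subset_trans IH.
apply: (@wf_reduction_not_borel _ _
  (fun u => SigSub (mem_set (Apt (conf u))) : set_type A)) => T treeT.
rewrite /restrict_to/= image_comp.
set phi := _ \o _; have {phi}-> : phi = pt \o conf by [].
split=> [IT [b bT]|wfT].
  apply: (Ibr (fun k => conf (mkseq b k))).
    by move=> k; exists (b k); rewrite mkseqS /conf foldl_rcons.
  by apply: Isub IT => _ [k _ <-]; exists (mkseq b k).
(* If the image of [T] is outside [I], the nodes [u] for which the image of [Tat u] is outside [I]
   include the root, and each has a child of the same kind by [Icup]; a branch through them is a
   branch of [T]. *)
pose Tat u := [set t | T t /\ prefix u t].
apply: contrapT => nIT; apply: wfT.
have [||b bP] := tree_branch (fun u => ~ I ((pt \o conf) @` Tat u)).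
- by move=> IT; apply: nIT; apply: Isub IT => _ [t Tt <-]; exists t => //; split; rewrite ?prefix0s.
- move=> u nIu; apply: contrapT => /forallNP/= Iun; apply: nIu.
  apply: (Isub _ ([set pt (conf u)] `|` \bigcup_n (pt \o conf) @` Tat (rcons u n))).
    move=> _ [t [Tt /prefixP[[|n v] tE]] <-]; first by left; rewrite tE cats0.
    right; exists n => //; exists t => //; split=> //.
    by apply/prefixP; exists v; rewrite tE cat_rcons.
  apply: IU; first exact/Ifin/finite_set1.
  apply: (Icup (conf u)) => [n _ [t [Tt /prefixP[v tE]] <-]|n]; last exact: contrapT.
  have <- : conf (rcons u n) = next (conf u) n by rewrite /conf foldl_rcons.
  by apply: (Econf _ v); rewrite -tE; apply: Ept.
exists b => n; apply: contrapT => nT; apply: (bP n); apply: Ifin.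
suff -> : Tat (mkseq b n) = set0 by rewrite image_set0.
by apply/seteqP; split=> // t [Tt pt_]; apply: nT; apply: treeT pt_ Tt.
Qed.

(** * Borel families of sets *)

Lemma finite_nat_bounded (A : set nat) :
  finite_set A <-> exists n, forall i, A i -> (i < n)%N.
Proof.
split=> [/finite_seqP[s ->]|[n An]]; last exact: sub_finite_set (finite_II n).
exists (\max_(i <- s) i).+1 => i /= si; rewrite ltnS.
exact: (leq_bigmax_seq (F := id)).
Qed.

(** Turns finiteness into countable quantifiers, from which [borel_finite] follows. *)
Lemma finite_countP {T : countType} (A : set T) :
  finite_set A <-> exists n, forall t, A t -> (pickle t < n)%N.
Proof.
have -> : finite_set A <-> finite_set (pickle @` A).
  split=> [|fA]; first exact: finite_image.
  apply: sub_finite_set (finite_preimage (f := pickle) _ fA).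
    by move=> x Ax; exists x.
  by move=> x y _ _; apply: (pcan_inj pickleK).
split=> [/finite_nat_bounded[n An]|[n An]].
  by exists n => t At; apply: An; exists t.
by apply/finite_nat_bounded; exists n => _ [t At <-]; apply: An.
Qed.

Lemma minimal_pickle {U : countType} (Q : U -> Prop) : (exists u, Q u) ->
  exists2 u, Q u & forall v, Q v -> (pickle u <= pickle v)%N.
Proof.
move=> [u0 Q0].
have ex : exists n, `[< exists2 u, Q u & pickle u = n >].
  by exists (pickle u0); apply/asboolP; exists u0.
case: (ex_minnP ex) => n /asboolP[u Qu <-] un; exists u => // v Qv.
by apply: un; apply/asboolP; exists v.
Qed.

Lemma injective_image_finite {T U : Type} {f : T -> U} {A : set T} :
  injective f -> finite_set (f @` A) -> finite_set A.
Proof.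
move=> finj fA; apply: sub_finite_set (finite_preimage _ fA).
  by move=> x Ax; exists x.
by move=> x y _ _; apply: finj.
Qed.

Lemma infinite_enum {X : countType} {A : set X} : infinite_set A ->
  exists2 f : nat -> X, injective f & range f = A.
Proof.
move=> infA.
have /card_set_bijP[g [_ ginj gsurj]] := eq_card_nat (countableP A) infA.
have /(_ _)/cid2-/all_sig2[f Af fK] n : exists2 x, A x & g x = n := gsurj n I.
exists f; first exact: (can_inj fK).
apply/seteqP; split=> [_ [n _ <-]//|x Ax].
by exists (g x) => //; apply: ginj; rewrite ?inE// fK.
Qed.

Lemma image_preimage_range {T U : Type} (f : T -> U) (A : set U) :
  f @` (f @^-1` A) = A `&` range f.
Proof.
apply/seteqP; split=> [_ [x Ax <-]|y [Ay [x _ xE]]]; first by split=> //; exists x.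
by exists x => //; rewrite /preimage /= xE.
Qed.

Lemma preimage_image_inj {T U : Type} (f : T -> U) (A : set T) :
  injective f -> f @^-1` (f @` A) = A.
Proof.
by move=> fi; apply/seteqP; split=> [x [y Ay /fi <-]//|x Ax]; exists x.
Qed.

Section Borel.
Context {X : eqType}.
Implicit Types I : set (set X).

Lemma borel_familyC I : borel_family I -> borel_family (~` I).
Proof. by move=> bI; have := sigma_algebraCD bI; rewrite setTD. Qed.

Lemma borel_bigcup (I : nat -> set (set X)) :
  (forall n, borel_family (I n)) -> borel_family (\bigcup_n I n).
Proof. by move=> bI; have := sigma_algebra_bigcup bI. Qed.

Lemma borel_const (Q : Prop) : borel_family [set _ : set X | Q].
Proof.
have [q|nq] := pselect Q; last first.
  have := @sigma_algebra0 _ setT (@open (two_pow X)).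
  by congr (smallest _ _ _); apply/seteqP; split.
suff -> : [set _ | Q] = ~` [set _ : set X | ~ Q].
  apply: borel_familyC; have := @sigma_algebra0 _ setT (@open (two_pow X)).
  by congr (smallest _ _ _); apply/seteqP; split.
by apply/seteqP; split=> [S _ /(_ q)|].
Qed.

Lemma borel_ex (U : countType) (I : U -> set (set X)) :
  (forall u, borel_family (I u)) -> borel_family [set S | exists u, I u S].
Proof.
move=> bI.
have -> : [set S | exists u, I u S] =
    \bigcup_n (if unpickle n is Some u then I u else [set _ | False]).
  apply/seteqP; split=> [S [u Iu]|S [n _]]; first by exists (pickle u); rewrite ?pickleK.
  by case: unpickle => // u Iu; exists u.
apply: borel_bigcup => n; case: unpickle => [u|]; first exact: bI.
exact: borel_const.
Qed.

Lemma borel_all (U : countType) (I : U -> set (set X)) :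
  (forall u, borel_family (I u)) -> borel_family [set S | forall u, I u S].
Proof.
move=> bI.
have -> : [set S | forall u, I u S] = ~` [set S | exists u, (~` I u) S].
  apply/seteqP; split=> [S IS [u]|S nIS u]; first exact.
  by apply: contrapT => nI; apply: nIS; exists u.
by apply: borel_familyC; apply: borel_ex => u; exact: borel_familyC (bI u).
Qed.

Lemma borelI I J : borel_family I -> borel_family J -> borel_family (I `&` J).
Proof.
move=> bI bJ.
have -> : I `&` J = [set S | forall b : bool, (if b then I else J) S].
  by apply/seteqP; split=> [S [? ?] []|S IJ]//; split; [apply: (IJ true)|apply: (IJ false)].
by apply: borel_all => -[].
Qed.

Lemma borel_impl (Q : Prop) I : (Q -> borel_family I) -> borel_family [set S | Q -> I S].
Proof.
move=> bI; have [q|nq] := pselect Q.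
  by have -> : [set S | Q -> I S] = I;
    [apply/seteqP; split=> [S /(_ q)|S IS]|apply: bI].
have -> : [set S | Q -> I S] = [set _ | True] by apply/seteqP; split=> // S _ /nq.
exact: borel_const.
Qed.

Lemma borel_coord x : borel_family [set S : set X | S x].
Proof.
apply: sub_sigma_algebra => /=.
have -> : char_set [set S : set X | S x] =
    (fun c : two_pow X => c x) @^-1` [set b : bool | b] by apply/seteqP; split.
by apply: open_comp; [move=> c _; apply: (@proj_continuous X (fun=> bool) x)|apply: discrete_open].
Qed.

End Borel.

(** On characteristic functions, taking the preimage under [g] is composition with [g], which is
    continuous. *)
Lemma borel_preimage {X Y : eqType} (g : Y -> X) (I : set (set Y)) :
  borel_family I -> borel_family [set S : set X | I (g @^-1` S)].
Proof.
pose r (c : two_pow X) : two_pow Y := c \o g.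
have rcont : continuous r.
  move=> c; apply/cvg_sup => y A.
  rewrite nbhsE => -[_ [[B _ <-] /= Bx] BA].
  apply: (@filterS _ _ _ ((fun c : two_pow X => c (g y)) @^-1` B)).
    by move=> d Bd; apply: BA.
  apply: (@proj_continuous X (fun=> bool) (g y) c).
  by apply: open_nbhs_nbhs; split=> //; apply: discrete_open.
move=> /(_ [set V | <<s @open (two_pow X) >> (r @^-1` V)]); apply.
split; first split => /=.
- by rewrite preimage_set0; apply: sigma_algebra0.
- by move=> V /sigma_algebraCD; rewrite !setTD preimage_setC.
- by move=> V bV; rewrite preimage_bigcup; apply: sigma_algebra_bigcup.
by move=> V oV; apply: sub_sigma_algebra => /=; apply: open_comp.
Qed.

(** * Ideals of the class B are Borel and Frechet *)

Lemma iso_preimage {X Y : Type} {I : set (set X)} {J : set (set Y)} :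
  ideal_iso I J -> exists2 f : X -> Y, bijective f & J = [set B | I (f @^-1` B)].
Proof.
move=> [f bf IJ]; exists f => //; apply/seteqP.
suff E B : f @` (f @^-1` B) = B by split=> B /=; rewrite ?IJ E.
have [g fK gK] := bf.
by rewrite image_preimage_range; apply/seteqP; split=> [y []//|y By]; split=> //; exists (g y).
Qed.

Lemma ideal_iso_sym {X Y : Type} {I : set (set X)} {J : set (set Y)} :
  ideal_iso I J -> ideal_iso J I.
Proof.
move=> [f [g fK gK] IJ]; exists g; first by exists f.
move=> B; rewrite IJ image_comp.
have -> : f \o g = id by apply/funext => y /=; rewrite gK.
by rewrite image_id.
Qed.

Lemma orth_preimage {X Y : Type} (f : X -> Y) (I : set (set X)) : bijective f ->
  orth [set B | I (f @^-1` B)] = [set B | orth I (f @^-1` B)].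
Proof.
move=> [g fK gK]; apply/seteqP; split=> B /= oB A IA.
  apply: (@injective_image_finite _ _ f); first exact: can_inj fK.
  apply: sub_finite_set (oB (f @` A) _).
    by move=> _ [x [Ax Bx] <-]; split=> //; exists x.
  by rewrite /= preimage_image_inj//; apply: can_inj fK.
apply: sub_finite_set (finite_image f (oB _ IA)) => y [Ay By].
by exists (g y); rewrite /preimage /= gK.
Qed.

(** The invariant for the induction on [classB]. The last clause, the Frechet property, makes it
    self-dual: the double orthogonal is again the Borel family [I]. *)
Definition tame (I : set (set nat)) : Prop :=
  [/\ forall A, finite_set A -> I A,
      forall A B, A `<=` B -> I B -> I A,
      borel_family I, borel_family (orth I)
    & orth (orth I) `<=` I].

Lemma orth_fin (X : Type) (I : set (set X)) A : finite_set A -> orth I A.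
Proof. by move=> fA B _; apply: sub_finite_set fA => x []. Qed.

Lemma orth_sub (X : Type) (I : set (set X)) A B : A `<=` B -> orth I B -> orth I A.
Proof. by move=> AB IB C /IB; apply: sub_finite_set => x [Cx /AB]. Qed.

Lemma orthU (X : Type) (I : set (set X)) A B :
  orth I A -> orth I B -> orth I (A `|` B).
Proof. by move=> IA IB C IC; rewrite setIUr finite_setU; split; [apply: IA|apply: IB]. Qed.

Lemma orth_orth (X : Type) (I : set (set X)) : I `<=` orth (orth I).
Proof. by move=> A IA B /(_ _ IA); rewrite setIC. Qed.

Lemma borel_finite {U : countType} {X : eqType} (K : U -> set (set X)) :
  (forall u, borel_family (K u)) ->
  borel_family [set S | finite_set [set u | K u S]].
Proof.
move=> bK.
have -> : [set S | finite_set [set u | K u S]] =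
    [set S | exists n, forall u, (n <= pickle u)%N -> (~` K u) S].
  apply/seteqP; split=> S /=.
    by move=> /finite_countP[n Kn]; exists n => u nu /Kn; rewrite ltnNge nu.
  move=> [n Kn]; apply/finite_countP; exists n => u KuS.
  by rewrite ltnNge; apply/negP => /Kn.
apply: borel_ex => n; apply: borel_all => u; apply: borel_impl => _.
exact: borel_familyC.
Qed.

Lemma orth_setT (X : Type) : orth [set: set X] = [set A | finite_set A].
Proof.
apply/seteqP; split=> A; last by move=> /= fA B _; apply: sub_finite_set fA => x [].
by move=> /(_ setT Logic.I); rewrite setTI.
Qed.

Lemma orth_finite_sets (X : Type) : orth [set A : set X | finite_set A] = setT.
Proof. by apply/seteqP; split=> // A _ B; apply: sub_finite_set => x []. Qed.

Lemma tame_fin : tame [set A | finite_set A].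
Proof.
split=> //; first by move=> A B; apply: sub_finite_set.
- exact: (borel_finite (fun u : nat => [set S : set nat | S u]) borel_coord).
- by rewrite orth_finite_sets; apply: borel_const.
- by rewrite orth_finite_sets orth_setT.
Qed.

Lemma tame_orth I : tame I -> tame (orth I).
Proof.
move=> [fI sI bI boI ooI]; split=> //.
- by move=> A; apply: orth_fin.
- by move=> A B; apply: orth_sub.
- suff -> : orth (orth I) = I by [].
  by apply/seteqP; split=> //; apply: orth_orth.
- by move=> A oA B /orth_orth/oA.
Qed.

Lemma tame_iso I J : tame I -> ideal_iso I J -> tame J.
Proof.
move=> [fI sI bI boI ooI] /iso_preimage[f bf ->]; split.
- move=> A fA; apply/fI/finite_preimage => // x y _ _; exact: bij_inj.
- by move=> A B AB; apply: sI => x; apply: AB.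
- exact: borel_preimage.
- by rewrite orth_preimage//; apply: borel_preimage.
- by rewrite (orth_preimage _ _ bf) (orth_preimage _ _ bf) => A /ooI.
Qed.

(** Orthogonality of a set inside the range of [f] depends only on the trace of [M] there, so
    orthogonals can be computed piece by piece. *)
Lemma orth_copy {X Y : Type} {I : set (set X)} {M : set (set Y)} {f : X -> Y} :
  (forall A B, A `<=` B -> M B -> M A) -> injective f ->
  (forall T, I T <-> M (f @` T)) ->
  forall A, orth M (A `&` range f) <-> orth I (f @^-1` A).
Proof.
move=> sM fi IM A; split=> [oA T /IM/oA fT|oA B MB].
  apply: injective_image_finite fi _; apply: sub_finite_set fT.
  by move=> _ [x [Tx Ax] <-]; split; [exists x|split => //; exists x].
have /oA fB : I (f @^-1` B).
  by apply/IM; rewrite image_preimage_range; apply: sM MB => x [].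
apply: sub_finite_set (finite_image f fB) => y [By [Ay [x _ xE]]].
by exists x => //; rewrite -xE in By Ay; split.
Qed.

(** If [A] met infinitely many pieces, one point of [A] chosen in each of them would give a set in
    [M] with infinite intersection with [A]. The converse is a finite union. *)
Lemma orth_sum {X : Type} {U : choiceType} {M : set (set X)} {D : set U} {K : U -> set X} :
  (forall A, finite_set A -> M A) -> (forall A B, A `<=` B -> M B -> M A) ->
  trivIset D K -> (forall S, M S <-> forall u, D u -> M (S `&` K u)) ->
  forall A, A `<=` \bigcup_(u in D) K u -> orth M A <-> (forall u, D u -> orth M (A `&` K u)) /\
    finite_set [set u | D u /\ A `&` K u !=set0].
Proof.
move=> fM sM tK MP A AK; split=> [oA|[oA fA] B /MP MB].
  split=> [u _|]; first by apply: orth_sub oA => x [].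
  have subsingleton_finite (T : Type) (S : set T) :
      (forall x y, S x -> S y -> x = y) -> finite_set S.
    move=> S1; have [[x Sx]|nS] := pselect (S !=set0).
      by apply: sub_finite_set (finite_set1 x) => y Sy; apply: S1.
    by suff -> : S = set0 by []; apply/seteqP; split=> // x Sx; apply: nS; exists x.
  (* The value [None] marks the pieces that miss [A]. *)
  have /(_ _)/cid-/all_sig[g gP] (u : U) : exists o : option X,
      if o is Some x then (A `&` K u) x else ~ (A `&` K u !=set0).
    have [[x Ax]|nA] := pselect (A `&` K u !=set0); first by exists (Some x).
    by exists None.
  pose P := [set x | exists u, D u /\ g u = Some x].
  have PK u x : D u -> K u x -> P x -> g u = Some x.
    move=> Du Kux [v [Dv gv]]; suff -> : u = v by [].
    by apply: tK => //; exists x; split=> //; have := gP v; rewrite gv => -[].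
  have /oA fPA : M P.
    apply/MP => u Du; apply: fM; apply: subsingleton_finite => x y [Px Kx] [Py Ky].
    by have := PK u x Du Kx Px; rewrite (PK u y Du Ky Py) => -[].
  apply: sub_finite_set (bigcup_finite fPA (_ : forall x, _ x ->
      finite_set [set u | D u /\ K u x])).
    move=> u [Du Au]; have := gP u; case gu: (g u) => [x|//] [Ax Kux].
    by exists x => //; split=> //; exists u.
  move=> x _; apply: subsingleton_finite => u v [Du Ku] [Dv Kv].
  by apply: tK => //; exists x.
apply: sub_finite_set (bigcup_finite fA (_ : forall u, _ u ->
    finite_set (B `&` (A `&` K u)))).
  move=> x [Bx Ax]; have [u Du Kx] := AK x Ax.
  by exists u => //; split=> //; exists x.
move=> u [Du _]; apply: sub_finite_set (oA u Du _ (MB u Du)) => x [Bx [Ax Kx]].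
by split.
Qed.

(** Removes the subtypes: the copy of [I n] becomes the trace of [S] on [K n]. The empty set must be
    in each [I n] so that a subset of one piece satisfies the conditions on the other pieces. *)
Lemma direct_sumP {D : set nat} {I : nat -> set (set nat)} {S : set (set nat)} :
  (forall n, D n -> I n set0) -> direct_sum D I S ->
  exists (K : nat -> set nat) (f : nat -> nat -> nat),
    [/\ partition D K setT, forall n, D n -> injective (f n),
        forall n, D n -> range (f n) = K n,
        forall n, D n -> forall T, I n T <-> S (f n @` T)
      & forall A, S A <-> forall n, D n -> S (A `&` K n)].
Proof.
move=> I0 [K [I' [[cK tK K0] II' SE]]].
have I'0 n : D n -> I' n set0.
  by move=> Dn; have [f _ fI] := II' n Dn; have := fI set0; rewrite image_set0 => <-; apply: I0.
have SK n B : D n -> S (B `&` K n) <-> I' n (set_val @^-1` B).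
  move=> Dn; rewrite SE /=; split=> [/(_ n Dn)|IB m Dm].
    by congr (I' n _); apply/seteqP; split=> [x [//]|x Bx]; split=> //; apply: set_valP.
  have [mn|mn] := eqVneq m n.
    move: IB; rewrite -{}mn; congr (I' m _).
    by apply/seteqP; split=> [x Bx|x [//]]; split=> //; apply: set_valP.
  suff -> : set_val @^-1` (B `&` K n) = set0 :> set (K m) by apply: I'0.
  apply/seteqP; split=> // x [_ Kx]; move/eqP: mn; apply.
  by apply: tK => //; exists (set_val x); split=> //; apply: set_valP.
have /(_ _)/cid-/all_sig[f fP] n : exists f : nat -> nat, D n ->
    [/\ injective f, range f = K n & forall T, I n T <-> S (f @` T)].
  have [Dn|nDn] := pselect (D n); last by exists id.
  have [g [h gK hK] gI] := II' n Dn; exists (set_val \o g) => _.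
  have rg : range (set_val \o g) = K n.
    apply/seteqP; split=> [_ [x _ <-]|x Kx]; first exact: set_valP.
    by exists (h (SigSub (mem_set Kx))) => //=; rewrite hK.
  split=> //; first by apply: inj_comp; [apply: val_inj|apply: can_inj gK].
  move=> T; rewrite gI; have -> : (set_val \o g) @` T = ((set_val \o g) @` T) `&` K n.
    by apply/seteqP; split=> [x Tx|x []//]; split=> //; rewrite -rg; case: Tx => y _ <-; exists y.
  rewrite SK//; suff -> : set_val @^-1` ((set_val \o g) @` T) = g @` T by [].
  by apply/seteqP; split=> [y [x Tx /val_inj<-]|_ [x Tx <-]]; exists x.
exists K, f; split=> //; [by move=> n /fP[]|by move=> n /fP[]|by move=> n /fP[]|].
by move=> A; rewrite {1}SE /=; split=> SA n Dn; apply/(SK n A Dn)/SA.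
Qed.

Lemma tame_sum D I S : (forall n, D n -> tame (I n)) -> direct_sum D I S -> tame S.
Proof.
move=> tI dS.
have [|K [f [[cK tK _] fi fr fI SK]]] := direct_sumP _ dS.
  by move=> n /tI[fI _ _ _ _]; apply: fI.
have fS A : finite_set A -> S A.
  move=> fA; apply/SK => n Dn; rewrite -fr// -image_preimage_range; apply/fI => //.
  have [fIn _ _ _ _] := tI n Dn; apply/fIn/finite_preimage => // x y _ _; exact: fi.
have sS A B : A `<=` B -> S B -> S A.
  move=> AB /SK SB; apply/SK => n Dn; move: (SB n Dn).
  rewrite -fr// -!image_preimage_range => /(fI _ Dn) IB; apply/(fI _ Dn).
  have [_ sIn _ _ _] := tI n Dn; apply: sIn IB => x; exact: AB.
rewrite /cover in cK.
have os A : orth S A <-> (forall n, D n -> orth S (A `&` K n)) /\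
    finite_set [set n | D n /\ A `&` K n !=set0].
  by apply: orth_sum => //; rewrite cK.
have SKI n A : D n -> S (A `&` K n) <-> I n (f n @^-1` A).
  by move=> Dn; rewrite -fr// -image_preimage_range; split=> /(fI _ Dn).
have oSKI n A : D n -> orth S (A `&` K n) <-> orth (I n) (f n @^-1` A).
  by move=> Dn; rewrite -fr//; exact: orth_copy sS (fi n Dn) (fI n Dn) A.
split=> //.
- have -> : S = [set A | forall n, D n -> I n (f n @^-1` A)].
    apply/seteqP; split=> A /=.
      by move=> /SK SA n Dn; apply/SKI => //; apply: SA.
    by move=> IA; apply/SK => n Dn; apply/SKI => //; apply: IA.
  apply: borel_all => n; apply: borel_impl => /tI[_ _ bI _ _].
  exact: borel_preimage.
- have -> : orth S = [set A | forall n, D n -> orth (I n) (f n @^-1` A)] `&`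
      [set A | finite_set [set n | D n /\ exists x, K n x /\ A x]].
    apply/seteqP; split=> A /=.
      move=> /os[oA fA]; split=> [n Dn|]; first by apply/oSKI => //; apply: oA.
      by apply: sub_finite_set fA => n [Dn [x [Kx Ax]]]; split=> //; exists x.
    move=> [oA fA]; apply/os; split=> [n Dn|]; first by apply/oSKI => //; apply: oA.
    by apply: sub_finite_set fA => n [Dn [x [Ax Kx]]]; split=> //; exists x.
  apply: borelI.
    apply: borel_all => n; apply: borel_impl => /tI[_ _ _ boI _].
    exact: borel_preimage.
  apply: (borel_finite (fun n => [set A | D n /\ exists x, K n x /\ A x])) => n.
  apply: (borelI [set _ | D n]); first exact: borel_const.
  apply: borel_ex => x; apply: (borelI [set _ | K n x]); first exact: borel_const.
  exact: borel_coord.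
(* A set orthogonal to [I n], transported into [K n], is orthogonal to [S]; such sets suffice to
   test [A] on the piece [K n]. *)
move=> A ooA; apply/SK => n Dn; apply/SKI => //.
have [_ _ _ _] := tI n Dn; apply => B oB.
have /ooA fAB : orth S (f n @` B).
  have -> : f n @` B = f n @` B `&` K n.
    by rewrite -fr//; apply/seteqP; split=> [x [y By <-]|x []//]; split; exists y.
  by apply/oSKI => //; rewrite preimage_image_inj//; apply: fi.
apply: (injective_image_finite (fi n Dn)); apply: sub_finite_set fAB.
by move=> _ [x [Bx Ax] <-]; split=> //; exists x.
Qed.

Lemma classB_tame I : classB I -> tame I.
Proof.
elim=> {I} [|D I S _ tI dS|I _ tI|I J _ tI IJ].
- exact: tame_fin.
- exact: tame_sum tI dS.
- exact: tame_orth.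
- exact: tame_iso tI IJ.
Qed.

Lemma iso_in_B_borel (X : countType) (I : set (set X)) : iso_in_B I -> borel_family I.
Proof.
move=> [J /classB_tame[_ _ bJ _ _] /ideal_iso_sym/iso_preimage[f _ ->]].
exact: borel_preimage.
Qed.

(** * Building ideals of the class B *)

(** An enumeration of [A] replaces the subtype, since the ideals of [classB] live on [nat]; in
    particular [A] is infinite. *)
Definition B_copy {X : Type} (I : set (set X)) (A : set X) : Prop :=
  exists f : nat -> X, [/\ injective f, range f = A & classB [set S | I (f @` S)]].

Lemma B_copy_iso (X : Type) (I : set (set X)) (A : set X) :
  B_copy I A -> iso_in_B (restrict_to I A).
Proof.
move=> [f [fi fA cB]]; exists [set S | I (f @` S)] => //; apply: ideal_iso_sym.
have Af n : f n \in A by apply/mem_set; rewrite -fA; exists n.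
exists (fun n => SigSub (Af n) : A); last by move=> S; rewrite /restrict_to/= image_comp.
have /(_ _)/cid-/all_sig[g gP] (x : A) : exists n, f n = set_val x.
  by have := set_valP x; rewrite -{1}fA => -[n _ nE]; exists n.
exists g => [n|x]; first by apply: fi; rewrite gP.
by apply: val_inj => /=; rewrite gP.
Qed.

(** Converse to [direct_sumP]: it recognises a direct sum from the traces of [M], and builds the
    copies on subtypes that the definition asks for. *)
Lemma classB_sum_copies {M : set (set nat)} {D : set nat} {K : nat -> set nat} :
  trivIset D K -> \bigcup_(n in D) K n = setT ->
  (forall n, D n -> B_copy M (K n)) ->
  (forall S, M S <-> forall n, D n -> M (S `&` K n)) -> classB M.
Proof.
move=> tK cK cM MP.
have /(_ _)/cid-/all_sig[f fP] n : exists f : nat -> nat, D n ->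
    [/\ injective f, range f = K n & classB [set S | M (f @` S)]].
  by have [/cM[f ?]|?] := pselect (D n); [exists f|exists id].
apply: (@classB_sum D (fun n => [set S | M (f n @` S)])) => [n /fP[]//|].
exists K, (fun n => restrict_to M (K n)); split.
- split=> // n /fP[_ <- _]; exists (f n 0); by exists 0.
- move=> n /fP[fi fK _].
  have Kf k : f n k \in K n by apply/mem_set; rewrite -fK; exists k.
  exists (fun k => SigSub (Kf k) : K n); last first.
    by move=> S; rewrite /restrict_to/= image_comp.
  have /(_ _)/cid-/all_sig[g gP] (x : K n) : exists k, f n k = set_val x.
    by have := set_valP x; rewrite -{1}fK => -[k _ kE]; exists k.
  exists g => [k|x]; first by apply: fi; rewrite gP.
  by apply: val_inj => /=; rewrite gP.
have imv n S : set_val @` (set_val @^-1` S : set (K n)) = S `&` K n.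
  apply/seteqP; split=> [_ [x Sx <-]|x [Sx Kx]]; first by split=> //; apply: set_valP.
  by exists (SigSub (mem_set Kx)).
apply/seteqP; split=> S; rewrite /restrict_to /=.
  by move=> /MP MS n Dn; rewrite /= imv; apply: MS.
by move=> MS; apply/MP => n Dn; have := MS n Dn; rewrite /= imv.
Qed.

(* Lets finite pieces, which a direct sum does not allow, be absorbed. *)
Lemma classB_add_point J : classB J -> classB [set S | J [set n | S n.+1]].
Proof.
elim=> {J} [|D I S cI IH dS|I _ IH|I J cI IH IJ].
- suff -> : [set S : set nat | [set A | finite_set A] [set n | S n.+1]] = [set S | finite_set S].
    exact: classB_fin.
  apply/seteqP; split=> S /= /finite_nat_bounded[m Sm]; apply/finite_nat_bounded.
    by exists m.+1 => -[|i]// Si; rewrite ltnS; apply: Sm.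
  by exists m => i /Sm; apply: ltnW.
- have [|K [f [[cK tK _] fi fr fI SK]]] := direct_sumP _ dS.
    by move=> n /cI/classB_tame[fI _ _ _ _]; apply: fI.
  rewrite /cover in cK; have [m0 Dm0 _] : (\bigcup_(n in D) K n) 0 by rewrite cK.
  (* The partition is shifted by one, and the new point 0 joins the piece [m0] that contained 0.
     That piece is treated by the induction hypothesis, the others are mere shifts. *)
  pose K' m := succn @` K m `|` [set i | i = 0 /\ m = m0].
  apply: (@classB_sum_copies _ D K').
  + move=> m n Dm Dn [i [Kmi Kni]].
    case: Kmi => [[j Kj ji]|[i0 mE]]; case: Kni => [[k Kk ki]|[i0' nE]].
    * apply: tK => //; exists j; split=> //.
      by move: ki; rewrite -ji => -[<-].
    * by move: ji; rewrite i0'.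
    * by move: ki; rewrite i0.
    * by rewrite mE nE.
  + apply/seteqP; split=> // -[|i] _; first by exists m0 => //; right.
    have [n Dn Ki] : (\bigcup_(n in D) K n) i by rewrite cK.
    by exists n => //; left; exists i.
  + move=> n Dn; have [nm|nm] := eqVneq n m0; last first.
      exists (succn \o f n); split.
      * by apply: inj_comp; [apply: succn_inj|apply: fi].
      * rewrite /K' -fr//; apply/seteqP; split=> [_ [k _ <-]|i].
          by left; exists (f n k) => //; exists k.
        by case=> [[_ [k _ <-] <-]|[_ /eqP]]; [exists k|rewrite (negbTE nm)].
      * have -> : [set T | [set A | S [set k | A k.+1]] ((succn \o f n) @` T)] = I n.
          suff e T : [set k | ((succn \o f n) @` T) k.+1] = f n @` T.
            by apply/seteqP; split=> T /=; rewrite e => /(fI n Dn).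
          apply/seteqP; split=> [k [j Tj /succn_inj <-]|_ [j Tj <-]]; first by exists j.
          by exists j.
        exact: cI.
    exists (fun k => if k is k'.+1 then (f n k').+1 else 0); split.
    * by move=> [|i] [|j]// [/(fi n Dn)->].
    * rewrite /K' -fr//; apply/seteqP; split=> [_ [[|k] _ <-]|i].
      - by right.
      - by left; exists (f n k) => //; exists k.
      - by case=> [[_ [k _ <-] <-]|[-> _]]; [exists k.+1|exists 0].
    * have -> : [set T | [set A | S [set k | A k.+1]]
          ((fun k => if k is k'.+1 then (f n k').+1 else 0) @` T)] =
          [set T | I n [set k | T k.+1]].
        suff e T : [set i | ((fun k => if k is k'.+1 then (f n k').+1 else 0) @` T) i.+1]
            = f n @` [set k | T k.+1].
          by apply/seteqP; split=> T /=; rewrite e => /(fI n Dn).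
        apply/seteqP; split=> [k [[//|j] Tj /succn_inj <-]|_ [j Tj <-]]; first by exists j.
        by exists j.+1.
      exact: IH.
  + move=> T; rewrite /= SK; split=> ST n Dn; have := ST n Dn.
      congr S; apply/seteqP; split=> k [Tk Kk]; split=> //.
        by left; exists k.
      by case: Kk => [[j Kj [<-]]|[]].
    congr S; apply/seteqP; split=> k [Tk Kk]; split=> //.
      by case: Kk => [[j Kj [<-]]|[]].
    by left; exists k.
- suff -> : [set S | orth I [set n | S n.+1]] = orth [set S | I [set n | S n.+1]].
    exact: classB_orthogonal.
  apply/seteqP; split=> S oS A IA.
    have /finite_nat_bounded[m Am] := oS _ IA; apply/finite_nat_bounded.
    by exists m.+1 => -[|i]// [Ai Si]; rewrite ltnS; apply: Am.
  have /oS/finite_nat_bounded[m Am] : [set S | I [set n | S n.+1]] (succn @` A).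
    suff e : [set n | (succn @` A) n.+1] = A by rewrite /= e.
    by apply/seteqP; split=> [n [k Ak /succn_inj <-]|n An]//; exists n.
  by apply/finite_nat_bounded; exists m => i [Ai Si]; apply: ltnW; apply: Am; split=> //; exists i.
- have [f [g fK gK] ->] := iso_preimage IJ.
  apply: (classB_iso IH).
  pose F k := if k is k'.+1 then (f k').+1 else 0.
  exists F.
    exists (fun k => if k is k'.+1 then (g k').+1 else 0) => -[|k]//; by rewrite /F /= ?fK ?gK.
  move=> S /=.
  suff -> : f @^-1` [set n | (F @` S) n.+1] = [set n | S n.+1] by [].
  apply/seteqP; split=> k /=; last by move=> Sk; exists k.+1.
  by case=> -[|j]// Sj /succn_inj/(can_inj fK)<-.
Qed.

Lemma ideal_bigcup (X U : Type) (I : set (set X)) (D : set U) (F : U -> set X) :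
  is_ideal I -> finite_set D -> (forall u, D u -> I (F u)) ->
  I (\bigcup_(u in D) F u).
Proof.
move=> [fI sI UI] fD IF.
suff H (E : set U) : finite_set E -> E `<=` D -> I (\bigcup_(u in E) F u) by apply: H.
move=> [n]; elim: n => [|n IH] in E *.
  by rewrite II0 card_eq0 => /eqP -> _; rewrite bigcup_set0; apply: fI.
move=> /eq_cardSP[u Eu En] ED; rewrite -(setD1K Eu) bigcup_setU1.
apply: UI; first exact/IF/ED.
by apply: IH En _ => v [/ED].
Qed.

Section Copies.
Context {X : countType} {I : set (set X)} (idI : is_ideal I).
Implicit Types A F Z : set X.

Let fI : forall A, finite_set A -> I A. Proof. by case: idI. Qed.
Let sI : forall A B, A `<=` B -> I B -> I A. Proof. by case: idI. Qed.
Let UI : forall A B, I A -> I B -> I (A `|` B). Proof. by case: idI. Qed.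

Lemma B_copy_add_point A x : ~ A x -> B_copy I A -> B_copy I (x |` A).
Proof.
move=> nAx [f [fi fA cB]]; exists (fun n => if n is n'.+1 then f n' else x).
have nf n : x <> f n by move=> xf; apply: nAx; rewrite -fA; exists n.
split.
- move=> [|m] [|n]// => [/nf//|/esym/nf//|/fi->//].
- rewrite -fA; apply/seteqP; split=> [_ [[|n] _ <-]|y [->|[n _ <-]]].
  + by left.
  + by right; exists n.
  + by exists 0.
  + by exists n.+1.
suff -> : [set S | I ((fun n => if n is n'.+1 then f n' else x) @` S)] =
    [set S | I (f @` [set n | S n.+1])] by apply: classB_add_point cB.
apply/seteqP; split=> S /= IS.
  by apply: sI IS => _ [n Sn <-]; exists n.+1.
apply: sI (UI _ _ (fI _ (finite_set1 x)) IS) => _ [[|n] Sn <-]; first by left.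
by right; exists n.
Qed.

Lemma B_copy_add_finite A F : finite_set F -> B_copy I A -> B_copy I (F `|` A).
Proof.
move=> /finite_seqP[s ->] cA; elim: s => [|x s IH]; first by rewrite (_ : [set` [::]] = set0) ?set0U//; apply/seteqP; split.
have -> : [set` x :: s] = x |` [set` s].
  apply/seteqP; split=> y /=; rewrite inE.
    by case/predU1P => [->|]; [left|right].
  by case=> [->|/= ->]; rewrite ?eqxx ?orbT.
rewrite -setUA.
have [sx|] := pselect (([set` s] `|` A) x); last by move=> /B_copy_add_point; apply.
by rewrite (_ : x |` _ = [set` s] `|` A)//; apply/setUidPr => _ ->.
Qed.

Lemma B_copy_preimage (f : nat -> X) Z : injective f -> Z `<=` range f -> B_copy I Z ->
  B_copy [set S | I (f @` S)] (f @^-1` Z).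
Proof.
move=> fi Zf [g [gi gZ cB]].
have /(_ _)/cid-/all_sig[h hP] n : exists m, f m = g n.
  by have [m _ mE] : range f (g n); [apply: Zf; rewrite -gZ; exists n|exists m].
exists h; split.
- by move=> m n hmn; apply: gi; rewrite -!hP hmn.
- apply/seteqP; split=> [_ [n _ <-]|m]; first by rewrite /preimage /= hP -gZ; exists n.
  by rewrite /preimage /= -gZ => -[n _ nm]; exists n => //; apply: fi; rewrite hP.
suff -> : [set S | [set T | I (f @` T)] (h @` S)] = [set S | I (g @` S)] by [].
by apply/funext => S /=; rewrite image_comp (_ : f \o h = g)//; apply/funext => n /=.
Qed.

(** The restriction is the full power set, the orthogonal of the ideal of finite sets. *)
Lemma B_copy_mem A : infinite_set A -> I A -> B_copy I A.
Proof.
move=> /infinite_enum[f fi fA] IA; exists f; split=> //.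
rewrite (_ : [set _ | _] = orth [set S | finite_set S]).
  exact/classB_orthogonal/classB_fin.
rewrite orth_finite_sets; apply/seteqP; split=> // S _.
by apply: sI IA => _ [n _ <-]; rewrite -fA; exists n.
Qed.

Lemma B_copy_finite A : infinite_set A -> (forall S, S `<=` A -> I S -> finite_set S) ->
  B_copy I A.
Proof.
move=> /infinite_enum[f fi fA] IA; exists f; split=> //.
rewrite (_ : [set _ | _] = [set S | finite_set S]); first exact: classB_fin.
apply/seteqP; split=> S /=; last by move=> ?; apply/fI/finite_image.
move=> /IA fS; apply: (injective_image_finite fi); apply: fS.
by move=> _ [n _ <-]; rewrite -fA; exists n.
Qed.

Lemma B_copy_sum A (D : set nat) (K : nat -> set X) : infinite_set A ->
  trivIset D K -> (forall n, D n -> K n `<=` A) -> A `<=` \bigcup_(n in D) K n ->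
  (forall n, D n -> B_copy I (K n)) ->
  (forall S, S `<=` A -> (forall n, D n -> I (S `&` K n)) -> I S) ->
  B_copy I A.
Proof.
move=> /infinite_enum[f fi fA] tK KA AK cK sumA; exists f; split=> //.
apply: (@classB_sum_copies _ D (fun n => f @^-1` K n)).
- by move=> m n Dm Dn [i [Km Kn]]; apply: tK => //; exists (f i).
- apply/seteqP; split=> // i _; have [|n Dn Kn] := AK (f i); first by rewrite -fA; exists i.
  by exists n.
- by move=> n Dn; apply: B_copy_preimage => //; [rewrite fA; apply: KA|apply: cK].
have imI S n : f @` (S `&` f @^-1` K n) = f @` S `&` K n.
  apply/seteqP; split=> [_ [i [Si Ki] <-]|_ [[i Si <-] Ki]]; last by exists i.
  by split=> //; exists i.
move=> S /=; split=> [IS n Dn|IS].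
  by apply: sI IS; rewrite imI => x [].
apply: sumA => [_ [i _ <-]|n Dn]; first by rewrite -fA; exists i.
by rewrite -imI; apply: IS.
Qed.

Definition finite_or_B A : Prop := finite_set A \/ B_copy I A.

Lemma finite_or_B_mem A : I A -> finite_or_B A.
Proof. by have [|/B_copy_mem] := pselect (finite_set A); [left|right; auto]. Qed.

(** The union [F] of the finite pieces belongs to [I]. A finite [F] is adjoined to the sum of the
    infinite pieces; an infinite [F] is one more summand, a full power set. *)
Lemma finite_or_B_sum A (K : nat -> set X) :
  trivIset setT K -> (forall n, K n `<=` A) -> A `<=` \bigcup_n K n ->
  (forall n, finite_or_B (K n)) ->
  (forall S, S `<=` A -> (forall n, I (S `&` K n)) -> I S) -> finite_or_B A.
Proof.
move=> tK KA AK gK sumA; have [|infA] := pselect (finite_set A); [by left|right].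
pose F := \bigcup_(n in [set n | finite_set (K n)]) K n.
have FA : F `<=` A by move=> x [n _ /KA].
have FK n : ~ finite_set (K n) -> F `&` K n = set0.
  move=> nf; apply/seteqP; split=> // x [[m /= fm Km] Kn]; apply: nf.
  by rewrite (tK n m)//; exists x.
have IF : I F.
  apply: sumA => // n; have [fn|nf] := pselect (finite_set (K n)).
    by apply: fI; apply: sub_finite_set fn => x [].
  by rewrite FK//; apply: fI.
have cK n : ~ finite_set (K n) -> B_copy I (K n) by have [] := gK n.
have [finF|infF] := pselect (finite_set F).
  rewrite -(setDUK FA); apply: B_copy_add_finite => //.
  apply: (@B_copy_sum _ [set n | ~ finite_set (K n)] K).
  - exact: infinite_setD.
  - by move=> m n _ _; apply: tK.
  - by move=> n nf x Kx; split=> [|Fx]; [apply: KA Kx|suff: (F `&` K n) x by rewrite FK].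
  - move=> x [Ax nFx]; have [n _ Kx] := AK x Ax; exists n => // fn; apply: nFx.
    by exists n.
  - exact: cK.
  move=> S SA IS; apply: sumA => [x /SA[]//|n].
  have [fn|nf] := pselect (finite_set (K n)); last exact: IS.
  by apply: fI; apply: sub_finite_set fn => x [].
(* Index 0 is reserved for [F], and the infinite [K n] moves to index [n.+1]. *)
pose D n := if n is n'.+1 then ~ finite_set (K n') else True.
apply: (@B_copy_sum _ D (fun n => if n is n'.+1 then K n' else F)) => //.
- move=> [|m] [|n] //= Dm Dn.
  + by rewrite FK// => -[].
  + by rewrite setIC FK// => -[].
  + by move=> /(tK m n Logic.I Logic.I)->.
- by case=> [|n] _ //.
- move=> x Ax; have [n _ Kx] := AK x Ax.
  have [fn|nf] := pselect (finite_set (K n)); first by exists 0 => //; exists n.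
  by exists n.+1.
- by case=> [|n] Dn; [apply: B_copy_mem|apply: cK].
move=> S SA IS; apply: sumA => // n.
have [fn|nf] := pselect (finite_set (K n)); last exact: (IS n.+1).
by apply: fI; apply: sub_finite_set fn => x [].
Qed.

End Copies.
Arguments finite_or_B {X} I A.

(* The ideal is the orthogonal of the direct sum of the orthogonals of the pieces. *)
Lemma finite_or_B_fsum {X : countType} {I : set (set X)} (idI : is_ideal I)
    (A : set X) (K : nat -> set X) :
  trivIset setT K -> (forall n, K n `<=` A) -> A `<=` \bigcup_n K n ->
  (forall n, finite_or_B I (K n)) ->
  (forall S, S `<=` A -> I S -> finite_set [set n | S `&` K n !=set0]) -> finite_or_B I A.
Proof.
move=> tK KA AK gK finA; have [fI sI UI] := idI.
(* [L] is the direct sum of the orthogonals of the pieces; the aim is that [orth L] and [I] agree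
   below [A]. *)
pose L := [set S | forall n, orth I (S `&` K n)].
have fL S : finite_set S -> L S.
  by move=> fS n; apply: orth_fin; apply: sub_finite_set fS => x [].
have sL S T : S `<=` T -> L T -> L S.
  by move=> ST LT n; apply: orth_sub (LT n) => x [/ST].
have idL : is_ideal L.
  by split=> // S T LS LT n; rewrite setIUl; apply: orthU.
have KmnI m n S : S `<=` K m -> m <> n -> S `&` K n = set0.
  move=> SK mn; apply/seteqP; split=> // x [/SK Kx Kn]; apply: mn.
  by apply: tK => //; exists x.
have LK n S : S `<=` K n -> L S <-> orth I S.
  move=> SK; split=> [/(_ n)|oS m]; first by rewrite setIidl.
  have [<-|nm] := pselect (n = m); first by apply: orth_sub oS => x [].
  by rewrite (KmnI _ _ _ SK nm); apply: orth_fin.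
have LP S : L S <-> forall n, setT n -> L (S `&` K n).
  split=> [LS n _|LS n]; first by apply: sL LS => x [].
  by apply/(LK n) => [x []//|]; apply: LS.
have copyK n (f : nat -> X) : injective f -> range f = K n ->
    [set T | L (f @` T)] = orth [set T | I (f @` T)].
  move=> fi fK; apply/seteqP; split=> T /=.
    move/(LK n); rewrite -fK => /(_ _) oT.
    have := (orth_copy (I := [set T | I (f @` T)]) sI fi (fun=> iff_refl _) (f @` T)).
    rewrite preimage_image_inj// => -[+ _]; apply.
    rewrite setIidl; first by apply: oT => _ [x _ <-]; exists x.
    by move=> _ [x _ <-]; exists x.
  have := (orth_copy (I := [set T | I (f @` T)]) sI fi (fun=> iff_refl _) (f @` T)).
  rewrite preimage_image_inj// => -[_ +] oT => /(_ oT).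
  have fTK : f @` T `<=` K n by rewrite -fK => _ [x _ <-]; exists x.
  by rewrite fK setIidl// => /(LK n); apply.
(* On an infinite piece this is the double orthogonal property of the ideals of B; on a finite one
   both sides hold. *)
have oLK n S : orth L (S `&` K n) <-> I (S `&` K n).
  have [fn|[f [fi fK cB]]] := gK n.
    split=> _; [apply: fI|apply: orth_fin]; by apply: sub_finite_set fn => x [].
  rewrite -fK; have -> := orth_copy (I := [set T | L (f @` T)]) sL fi (fun=> iff_refl _) S.
  rewrite (copyK n)// -image_preimage_range.
  have [_ _ _ _ ooI] := classB_tame _ cB.
  by split=> [/ooI//|?]; apply: orth_orth.
have oL Z : Z `<=` A -> orth L Z <-> I Z.
  move=> ZA; have -> := orth_sum fL sL tK LP Z (subset_trans ZA AK).
  split=> [[IZ fZ]|IZ].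
    apply: (sI _ (\bigcup_(n in [set n | Z `&` K n !=set0]) (Z `&` K n))).
      move=> x Zx; have [n _ Kx] := AK x (ZA x Zx).
      by exists n => //; exists x.
    apply: ideal_bigcup => // [|n _]; last exact/oLK/IZ.
    by apply: sub_finite_set fZ => n.
  split=> [n _|]; first by apply/oLK; apply: sI IZ => x [].
  by apply: sub_finite_set (finA Z ZA IZ) => n [].
have [fA|] : finite_or_B L A.
- apply: (finite_or_B_sum idL A K) => // [n|S SA LS]; last by apply/LP => n _.
  have [fn|[f [fi fK cB]]] := gK n; [by left|right].
  by exists f; split=> //; rewrite (copyK n)//; apply: classB_orthogonal.
- by left.
move=> [f [fi fA cB]]; right; exists f; split=> //.
suff -> : [set S | I (f @` S)] = orth [set S | L (f @` S)] by apply: classB_orthogonal.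
apply/funext => S /=; apply/propext.
have fSA : f @` S `<=` A by rewrite -fA => _ [x _ <-]; exists x.
rewrite -oL//.
have := orth_copy (I := [set T | L (f @` T)]) sL fi (fun=> iff_refl _) (f @` S).
rewrite preimage_image_inj// setIidl => [//|]; rewrite fA//.
Qed.

(** Quantifying over all subsets makes the property monotone, so its failure passes to supersets:
    the negation is the badness to be split. *)
Definition hereditary_B {X : countType} (I : set (set X)) (A : set X) : Prop :=
  forall B, B `<=` A -> finite_or_B I B.

Section HGood.
Context {X : countType} {I : set (set X)} (idI : is_ideal I).
Implicit Types A B : set X.

Lemma hereditary_B_iso A : hereditary_B I A -> infinite_set A -> iso_in_B (restrict_to I A).
Proof. by move=> /(_ A)[//|? []//|? _]; apply: B_copy_iso. Qed.

Lemma hereditary_B_sub A B : A `<=` B -> hereditary_B I B -> hereditary_B I A.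
Proof. by move=> AB gB C CA; apply/gB/(subset_trans CA). Qed.

Lemma hereditary_B_mem A : I A -> hereditary_B I A.
Proof. by have [_ sI _] := idI; move=> IA B BA; apply: finite_or_B_mem => //; apply: sI IA. Qed.

Section Sums.
Context {U : countType} (K : U -> set X) (A : set X).
Hypothesis K_inj : forall u v x, K u x -> K v x -> u = v.
Hypothesis AK : forall x, A x -> exists u, K u x.
Hypothesis gK : forall u, hereditary_B I (K u).

(** [pickle_inv] rather than [unpickle]: a number that is not a code gets the empty piece, so no
    piece is repeated and disjointness survives the reindexing. *)
Let P B n := if @pickle_inv U n is Some u then B `&` K u else set0.

Let PE B u : P B (pickle u) = B `&` K u.
Proof. by rewrite /P pickleK_inv. Qed.

Let PT B : trivIset setT (P B).
Proof.
move=> m n _ _ [x []]; rewrite /P.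
case: (@pickle_inv U m) (@pickle_invK U m) => //= u um [_ Ku].
case: (@pickle_inv U n) (@pickle_invK U n) => //= v vn [_ Kv].
by rewrite -um -vn (K_inj _ _ _ Ku Kv).
Qed.

Let PB B n : P B n `<=` B.
Proof. by rewrite /P; case: pickle_inv => // u x []. Qed.

Let BP B : B `<=` A -> B `<=` \bigcup_n P B n.
Proof.
by move=> BA x Bx; have [u Kux] := AK x (BA x Bx); exists (pickle u); rewrite ?PE.
Qed.

Let gP B n : finite_or_B I (P B n).
Proof.
rewrite /P; case: pickle_inv => [u|]; last by left.
by apply: (gK u) => x [].
Qed.

Lemma hereditary_B_sum :
  (forall S, S `<=` A -> (forall u, I (S `&` K u)) -> I S) -> hereditary_B I A.
Proof.
move=> sumA B BA; apply: (finite_or_B_sum idI B (P B)) => //; first exact: BP.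
move=> S SB IS; apply: sumA => [|u]; first exact: subset_trans BA.
by have := IS (pickle u); rewrite PE setIA (setIidl SB).
Qed.

Lemma hereditary_B_fsum :
  (forall S, S `<=` A -> I S -> finite_set [set u | S `&` K u !=set0]) -> hereditary_B I A.
Proof.
move=> finA B BA; apply: (finite_or_B_fsum idI B (P B)) => //; first exact: BP.
move=> S SB IS.
apply: sub_finite_set (finite_image pickle (finA S (subset_trans SB BA) IS)) => n.
move=> [x []]; rewrite /P.
case: (@pickle_inv U n) (@pickle_invK U n) => //= u un Sx [Bx Kx].
by exists u => //; exists x.
Qed.

End Sums.

Lemma hereditary_BU A B : hereditary_B I A -> hereditary_B I B -> hereditary_B I (A `|` B).
Proof.
move=> gA gB; apply: (hereditary_B_sum (fun b : bool => if b then A else B `\` A)).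
- by case=> -[] x //= => [? []|[]].
- move=> x ABx; have [Ax|nAx] := pselect (A x); [by exists true|exists false].
  by split=> //; case: ABx.
- by case=> //; apply: hereditary_B_sub gB => x [].
have [_ sI UI] := idI.
move=> S SAB IS; apply: sI (UI _ _ (IS true) (IS false)) => x Sx /=.
have [Ax|nAx] := pselect (A x); [by left|right].
by split=> //; split=> //; case: (SAB x Sx).
Qed.

End HGood.

(** * Well founded trees *)

Lemma prefix_mkseq (b : nat -> nat) m n : (m <= n)%N -> prefix (mkseq b m) (mkseq b n).
Proof. by move=> mn; rewrite prefixE size_mkseq mkseq_take. Qed.

Lemma prefix_comparable {T : eqType} {s t x : seq T} :
  prefix s x -> prefix t x -> (size s <= size t)%N -> prefix s t.
Proof.
rewrite !prefixE => /eqP sx /eqP tx st.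
by rewrite -{1}tx take_takel// sx.
Qed.

Lemma prefix_nth {T : eqType} x0 {s t : seq T} i :
  prefix s t -> (i < size s)%N -> nth x0 t i = nth x0 s i.
Proof. by move=> /prefixP[u ->] it; rewrite nth_cat it. Qed.

Lemma prefix_rcons_inj {T : eqType} {s x : seq T} {m n} :
  prefix (rcons s m) x -> prefix (rcons s n) x -> m = n.
Proof.
have H k : prefix (rcons s k) x -> nth m x (size s) = k.
  by move=> /(prefix_nth m (size s))->; rewrite ?nth_rcons ?size_rcons ?ltnn ?eqxx.
by move=> /H <- /H.
Qed.

Lemma chain_limit (t : nat -> seq nat) : (forall k, prefix (t k) (t k.+1)) ->
  exists b : nat -> nat, forall k, mkseq b (size (t k)) = t k.
Proof.
move=> tS; have tle k l : (k <= l)%N -> prefix (t k) (t l).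
  by move=> kl; rewrite -(subnKC kl); elim: (l - k)%N => [|j /prefix_trans->//];
    rewrite ?addn0 ?prefix_refl ?addnS.
have /(_ _)/cid-/all_sig[b bP] i : exists v, forall k, (i < size (t k))%N -> nth 0 (t k) i = v.
  (* If the chain stabilises, the positions beyond every [t k] get the value 0. *)
  have [[k ik]|nk] := pselect (exists k, (i < size (t k))%N); last first.
    by exists 0 => k ik; exfalso; apply: nk; exists k.
  exists (nth 0 (t k) i) => l il; have [/tle kl|/ltnW/tle lk] := leqP k l.
    by rewrite (prefix_nth 0 i kl).
  by rewrite (prefix_nth 0 i lk).
exists b => k; apply: (@eq_from_nth _ 0); rewrite size_mkseq// => i ik.
by rewrite nth_mkseq// -(bP i k ik).
Qed.

(** The least tree containing [S] is the set of prefixes of its elements, so only its branches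
    matter. *)
Lemma IwfP S : Iwf S <-> ~ exists b, forall n, exists2 t, S t & prefix (mkseq b n) t.
Proof.
split=> [[T [treeT wfT] ST] [b bS]|nb].
  by apply: wfT; exists b => n; have [t /ST Tt /treeT] := bS n; apply.
exists [set s | exists2 t, S t & prefix s t]; last by move=> t St; exists t; rewrite ?prefix_refl.
by split=> // s t st [u Su tu]; exists u => //; apply: prefix_trans tu.
Qed.

Lemma Iwf_ideal : is_ideal Iwf.
Proof.
split=> [A fA|A B AB|A B].
- apply/IwfP => -[b bA].
  have /finite_nat_bounded[m Am] : finite_set (size @` A) by apply: finite_image.
  have [t At /size_prefix] := bA m; rewrite size_mkseq leqNgt Am//.
  by exists t.
- move=> /IwfP nb; apply/IwfP => -[b bA]; apply: nb; exists b => n.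
  by have [t /AB Bt bt] := bA n; exists t.
move=> /IwfP nA /IwfP nB; apply/IwfP => -[b bAB].
(* If no element of [A] extends the segment of length [m], the elements extending all longer
   segments come from [B]. *)
apply: nA; exists b => m; apply: contrapT => nA; apply: nB; exists b => n.
have [t [At|Bt] bt] := bAB (maxn m n); last first.
  by exists t => //; apply: prefix_trans bt; rewrite prefix_mkseq// leq_maxr.
exfalso; apply: nA; exists t => //; apply: prefix_trans bt.
by rewrite prefix_mkseq// leq_maxl.
Qed.

Definition cone (t : seq nat) : set (seq nat) := [set s | prefix t s].

(** A branch approximated by elements above [t] passes through [t] and then through one child of
    [t], whose cone already contains approximations of it. *)
Lemma Iwf_cone t S : S `<=` cone t -> (forall n, Iwf (S `&` cone (rcons t n))) -> Iwf S.
Proof.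
move=> St IS; apply/IwfP => -[b bS].
have tE : t = mkseq b (size t).
  have [x /St tx bx] := bS (size t).
  have := prefix_comparable tx bx; rewrite size_mkseq leqnn => /(_ isT).
  by rewrite prefixE take_oversize ?size_mkseq// => /eqP->.
have /IwfP := IS (b (size t)); apply; exists b => n.
have [x Sx bx] := bS (maxn n (size t).+1); exists x; last first.
  by apply: prefix_trans bx; rewrite prefix_mkseq// leq_maxl.
split=> //; rewrite /cone /= {1}tE -mkseqS; apply: prefix_trans bx.
by rewrite prefix_mkseq// leq_maxr.
Qed.

Section Iwf.
Variable A : set (seq nat).

Let bad t : Prop := ~ hereditary_B Iwf (A `&` cone t).

Let bad_prefix s t : prefix s t -> bad t -> bad s.
Proof.
move=> st bt gs; apply: bt; apply: hereditary_B_sub gs => x [Ax /= tx].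
by split=> //; apply: prefix_trans st tx.
Qed.

Let C t : set (seq nat) :=
  [set x | [/\ A x, prefix t x & forall n, bad (rcons t n) -> ~ prefix (rcons t n) x]].

(** By [Iwf_cone] the trace on [C t] is a direct sum over the children of [t], plus the point [t]
    (index [None]). Good children contribute hereditary pieces, bad ones empty pieces. *)
Let hereditary_BC t : hereditary_B Iwf (C t).
Proof.
apply: (hereditary_B_sum Iwf_ideal
  (fun o => if o is Some n then C t `&` cone (rcons t n) else [set t])).
- have nt n : ~ prefix (rcons t n) t.
    by move=> /size_prefix; rewrite size_rcons ltnn.
  move=> [m|] [n|] x //=.
  + by move=> [_ xm] [_ xn]; rewrite (prefix_rcons_inj xm xn).
  + by move=> [_ xm] xE; rewrite xE in xm; case: (nt m).
  + by move=> xE [_ xn]; rewrite xE in xn; case: (nt n).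
- move=> x Cx; have [_ /prefixP[[|n u] xE] _] := Cx.
    by exists None; rewrite /= xE cats0.
  by exists (Some n); split=> //; rewrite /cone /= xE -cat_rcons prefix_prefix.
- move=> [n|]; last by apply: (hereditary_B_mem Iwf_ideal); case: Iwf_ideal => + _ _; apply.
  have [bn|/contrapT gn] := pselect (bad (rcons t n)); last first.
    by apply: hereditary_B_sub gn => x [[Ax _ _] xn].
  apply: (hereditary_B_mem Iwf_ideal); rewrite (_ : _ `&` _ = set0).
    by case: Iwf_ideal => + _ _; apply.
  by apply/seteqP; split=> // x [[_ _ /(_ n bn)]].
move=> S SC IS; apply: (Iwf_cone t) => [x /SC[]//|n].
by have := IS (Some n); rewrite setIA (setIidl SC).
Qed.

(** Otherwise the bad nodes above [s] branch finitely. Sorting each point by the last bad node on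
    its way from [s] cuts [A] above [s] into parts of the sets [C t]. By König's lemma a set in
    [Iwf] meets finitely many of these, so [s] is good by [hereditary_B_fsum]. *)
Let splitting s : bad s ->
  exists2 t, prefix s t & forall m, exists2 n, (m <= n)%N & bad (rcons t n).
Proof.
move=> bs; apply: contrapT => ns; apply: (bs).
have fin t : prefix s t -> exists m, forall n, (m <= n)%N -> ~ bad (rcons t n).
  move=> st; apply: contrapT => nt; apply: ns; exists t => // m.
  apply: contrapT => nm; apply: nt; exists m => n mn bn; apply: nm; by exists n.
pose K t := [set x | [/\ prefix s t, bad t & C t x]].
have Kprefix t u x : K t x -> K u x -> (size t <= size u)%N -> t = u.
  move=> [_ _ [_ tx nt]] [_ bu [_ ux _]] tu.
  have /prefixP[[|n v] uE] := prefix_comparable tx ux tu; first by rewrite uE cats0.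
  have tnu : prefix (rcons t n) u by rewrite uE -cat_rcons prefix_prefix.
  by case: (nt n); [apply: bad_prefix tnu bu|apply: prefix_trans tnu ux].
apply: (hereditary_B_fsum Iwf_ideal K).
- move=> t u x Kt Ku; have [tu|/ltnW ut] := leqP (size t) (size u).
    exact: Kprefix Kt Ku tu.
  by rewrite (Kprefix _ _ _ Ku Kt ut).
- move=> x [Ax sx].
  (* Starting from [s], pass to the bad child below [x] as long as there is one; [size x] bounds the
     descent. *)
  suff H k t : (size x - size t <= k)%N -> prefix s t -> prefix t x -> bad t ->
      exists u, K u x by apply: (H _ s (leqnn _)) => //; apply: prefix_refl.
  elim: k t => [|k IH] t xtk st tx bt.
    exists t; split=> //; split=> // n _ /size_prefix.
    by rewrite size_rcons ltnNge -subn_eq0 -leqn0 xtk.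
  have [Ct|nC] := pselect (C t x); first by exists t.
  have [n bn tnx] : exists2 n, bad (rcons t n) & prefix (rcons t n) x.
    apply: contrapT => nn; apply: nC; split=> // n bn tnx; apply: nn; by exists n.
  apply: (IH (rcons t n)) => //; last exact: prefix_trans st (prefix_rcons _ _).
  by rewrite size_rcons subnS; case: (_ - _)%N xtk.
- by move=> t; apply: hereditary_B_sub (hereditary_BC t) => x [].
move=> S SA IS; apply: contrapT => infQ.
pose Q := [set t | S `&` K t !=set0].
(* König's lemma: infinitely many nodes of [Q] give a branch with infinitely many of them above each
   segment, hence a branch through prefixes of [S]. *)
have [||b bQ] := tree_branch (fun u => infinite_set (Q `&` cone u)).
- by apply: sub_infinite_set infQ => t Qt; split=> //; rewrite /cone /= prefix0s.
- move=> u infu; apply: contrapT => /forallNP/= fin_u; apply: infu.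
  (* Shorter than [s], a node has its continuation dictated by [s]; from [s] on, a child below some
     node of [Q] is bad, and [fin] bounds the bad children. *)
  have [m Qm] : exists m, forall n t, Q t -> prefix (rcons u n) t -> (n < m)%N.
    have [su|us] := leqP (size s) (size u); last first.
      exists (nth 0 s (size u)).+1 => n t [x [_ [st _ _]]] ut.
      rewrite ltnS -(prefix_nth 0 _ st us) (prefix_nth 0 _ ut) ?size_rcons//.
      by rewrite nth_rcons ltnn eqxx.
    have [[t0 [[x [_ [st0 _ _]]] ut0]]|nQ] := pselect (Q `&` cone u !=set0); last first.
      exists 0 => n t Qt ut; exfalso; apply: nQ; exists t; split=> //.
      exact: prefix_trans (prefix_rcons _ _) ut.
    have [m mP] := fin u (prefix_comparable st0 ut0 su).
    exists m => n t [y [_ [_ bt _]]] ut; rewrite ltnNge; apply/negP => /mP; apply.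
    exact: bad_prefix ut bt.
  apply: (sub_finite_set (B := [set u] `|` \bigcup_(n in `I_m) (Q `&` cone (rcons u n)))).
    move=> t [Qt /prefixP[[|n v] tE]]; first by left; rewrite tE cats0.
    have ut : prefix (rcons u n) t by rewrite tE -cat_rcons prefix_prefix.
    by right; exists n; [apply: Qm ut|].
  rewrite finite_setU; split; first exact: finite_set1.
  apply: bigcup_finite => [|n _]; first exact: finite_II.
  exact: contrapT (fin_u n).
have /IwfP := IS; apply; exists b => n.
have /infinite_setN0[t [[x [Sx [_ _ [_ tx _]]]] bt]] := bQ n.
by exists x => //; apply: prefix_trans bt tx.
Qed.

(** Configurations are bad nodes, and the successors of a node are bad children, of unbounded index,
    of one node above it. Nodes lengthen strictly, so an infinite run converges to a branch. *)
Lemma Iwf_borel_hereditary_B : borel_family (restrict_to Iwf A) -> hereditary_B Iwf A.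
Proof.
move=> bI; apply: contrapT => nA.
have bad0 : bad [::].
  by move=> gA; apply: nA; apply: hereditary_B_sub gA => x Ax; split=> //; rewrite /cone /= prefix0s.
have /(_ _)/cid-/all_sig[pt ptP] (c : {t | bad t}) : exists x, (A `&` cone (sval c)) x.
  apply: contrapT => /forallNP n0; case: c n0 => t bt /= n0; apply: bt.
  rewrite (_ : _ `&` _ = set0); last by apply/seteqP; split.
  by apply: (hereditary_B_mem Iwf_ideal); case: Iwf_ideal => + _ _; apply.
have /(_ _)/cid-/all_sig[next nextP] (c : {t | bad t}) : exists nx : nat -> {t | bad t},
    exists2 t, prefix (sval c) t &
      forall n, exists2 k, (n <= k)%N & sval (nx n) = rcons t k.
  case: c => s /= /splitting[t st tn].
  have /(_ _)/cid2-/all_sig2[k mk bk] := tn.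
  by exists (fun n => exist _ _ (bk n)); exists t => // n; exists (k n).
apply: (@scheme_not_borel _ Iwf A _ (exist _ _ bad0) pt
  (fun c => A `&` cone (sval c)) next Iwf_ideal _ ptP) bI.
- by move=> c; case: (ptP c).
- move=> c n x [Ax xn]; split=> //; have [t ct tn] := nextP c.
  have [k _ nE] := tn n; rewrite /cone /= nE in xn.
  exact: prefix_trans (prefix_trans ct (prefix_rcons _ _)) xn.
- move=> c S SE IS; have [t ct tn] := nextP c.
  have Sn n x : S n x -> exists2 k, (n <= k)%N & prefix (rcons t k) x.
    by move=> /SE[_]; have [k nk ->] := tn n; exists k.
  apply: (Iwf_cone t) => [x [n _ /Sn[k _ xk]]|k].
    exact: prefix_trans (prefix_rcons _ _) xk.
  (* The [n]-th successor sits at a child of index at least [n], so only the [S n] with [n <= k]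
     reach the cone of child [k]. *)
  have [_ sI _] := Iwf_ideal; apply: (sI _ (\bigcup_(n in `I_k.+1) S n)).
    move=> x [[n _ Sx] xk]; have [j nj xj] := Sn n x Sx; exists n => //=.
    by rewrite ltnS -(prefix_rcons_inj xj xk).
  by apply: (ideal_bigcup _ _ _ _ _ Iwf_ideal (finite_II _)) => n _; apply: IS.
move=> c cn /IwfP; apply.
have cS k : prefix (sval (c k)) (sval (c k.+1)) /\
    (size (sval (c k)) < size (sval (c k.+1)))%N.
  have [n ->] := cn k; have [t ct tn] := nextP (c k); have [j _ ->] := tn n.
  split; first exact: prefix_trans ct (prefix_rcons _ _).
  by rewrite size_rcons ltnS; apply: size_prefix.
have [|b bP] := chain_limit (fun k => sval (c k)); first by move=> k; case: (cS k).
exists b => n; exists (pt (c n)); first by exists n.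
have cb : (n <= size (sval (c n)))%N.
  by elim: n => // n IH; apply: leq_ltn_trans IH _; case: (cS n).
apply: prefix_trans (prefix_mkseq b _ _ cb) _; rewrite bP.
by case: (ptP (c n)).
Qed.

End Iwf.

(** * Well ordered sets of rationals *)

Section WOQ.
Import Order.TTheory.

Lemma WOQ_ideal : is_ideal WOQ.
Proof.
have U A B : WOQ A -> WOQ B -> WOQ (A `|` B).
  move=> wA wB S SAB S0.
  have [SA0|/eqP/set0P SA] := pselect (S `&` A = set0).
    apply: wB S0 => x Sx; case: (SAB x Sx) => // Ax.
    by have : (S `&` A) x by []; rewrite SA0.
  have [SB0|/eqP/set0P SB] := pselect (S `&` B = set0).
    apply: wA S0 => x Sx; case: (SAB x Sx) => // Bx.
    by have : (S `&` B) x by []; rewrite SB0.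
  have [a [Sa Aa] am] := wA _ (@subIsetr _ S A) SA.
  have [b [Sb Bb] bm] := wB _ (@subIsetr _ S B) SB.
  have [ab|/ltW ba] := leP a b.
    by exists a => // x Sx; have [?|?] := SAB x Sx; [exact: am|exact: le_trans ab (bm x _)].
  by exists b => // x Sx; have [?|?] := SAB x Sx; [exact: le_trans ba (am x _)|exact: bm].
split=> // [A /finite_seqP[s ->]|A B AB wB C CA]; last by apply/wB/(subset_trans CA).
elim: s => [|x s IH]; first by move=> B B0 [y /B0].
have -> : [set` x :: s] = [set x] `|` [set` s].
  apply/seteqP; split=> y /=; rewrite inE.
    by case/predU1P => [->|]; [left|right].
  by case=> [->|/= ->]; rewrite ?eqxx ?orbT.
apply: U IH => B Bx [y By]; exists y => // z Bz.
by rewrite (Bx z Bz) (Bx y By).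
Qed.

Let bad P := ~ hereditary_B WOQ P.

Let below (P : set rat) (z : rat) := P `&` [set x | (x < z)%R].
Let above (P : set rat) (z : rat) := P `&` [set x | (z < x)%R].

Let hereditary_B1 (x : rat) : hereditary_B WOQ [set x].
Proof.
by apply: (hereditary_B_mem WOQ_ideal); case: WOQ_ideal => + _ _; apply.
Qed.

Let hereditary_B0 : hereditary_B WOQ set0.
Proof.
by apply: (hereditary_B_mem WOQ_ideal); case: WOQ_ideal => + _ _; apply.
Qed.

(* Each [q] of [L] that exceeds the points of [L] enumerated before it ends a piece:
   the pieces increase along the enumeration, so that well ordered traces suffice. *)
Let hereditary_B_below P (L := [set z | P z /\ hereditary_B WOQ (below P z)]) : hereditary_B WOQ L.
Proof.
pose K q := [set w | [/\ L q, L w, (w <= q)%R &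
  forall r, L r -> (pickle r < pickle q)%N -> (r < w)%R]].
have cov x : L x -> exists q, K q x.
  move=> Lx; have [|q [Lq xq] qmin] := minimal_pickle (fun q => L q /\ (x <= q)%R).
    by exists x.
  exists q; split=> // r Lr rq; rewrite ltNge; apply/negP => xr.
  by have := qmin r (conj Lr xr); rewrite leqNgt rq.
apply: (hereditary_B_sum WOQ_ideal K) => //.
- move=> q r x [Lq Lx xq qx] [Lr _ xr rx].
  case: (ltngtP (pickle q) (pickle r)) => [/(rx q Lq)|/(qx r Lr)|/(pcan_inj pickleK)//].
    by rewrite ltNge xq.
  by rewrite ltNge xr.
- move=> q; have [Lq|nLq] := pselect (L q); last first.
    by apply: hereditary_B_sub hereditary_B0 => x [].
  case: (Lq) => _ gq; apply: hereditary_B_sub (hereditary_BU WOQ_ideal _ _ gq (hereditary_B1 q)) => x [_ [Px _]].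
  by rewrite le_eqVlt => /predU1P[->|xq] _; [right|left].
move=> S SL wS B BS [b0 Bb0].
(* Among the pieces that [B] meets, the one enumerated first lies below all the others, so its
   minimum is that of [B]. *)
have [|q [x0 [Bx0 Kx0]] qmin] := minimal_pickle (fun q => B `&` K q !=set0).
  have [q Kq] := cov b0 (SL _ (BS _ Bb0)); by exists q, b0.
have [||m [Bm [Lq Lm mq _]] mmin] := wS q (B `&` K q); first by move=> x [/BS].
  by exists x0.
exists m => // x Bx; have [r Kr] := cov x (SL _ (BS _ Bx)).
have := qmin r (ex_intro _ x (conj Bx Kr)); rewrite leq_eqVlt => /predU1P[|qr].
  by move=> /(pcan_inj pickleK) qr; apply: mmin; rewrite qr.
by apply: le_trans mq _; apply: ltW; case: Kr => _ _ _; apply.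
Qed.

(* The pieces now decrease along the enumeration, so that a well ordered set meets
   only finitely many of them. *)
Let hereditary_B_above P (U := [set z | P z /\ hereditary_B WOQ (above P z)]) : hereditary_B WOQ U.
Proof.
pose K q := [set w | [/\ U q, U w, (q <= w)%R &
  forall r, U r -> (pickle r < pickle q)%N -> (w < r)%R]].
have cov x : U x -> exists q, K q x.
  move=> Ux; have [|q [Uq xq] qmin] := minimal_pickle (fun q => U q /\ (q <= x)%R).
    by exists x.
  exists q; split=> // r Ur rq; rewrite ltNge; apply/negP => xr.
  by have := qmin r (conj Ur xr); rewrite leqNgt rq.
apply: (hereditary_B_fsum WOQ_ideal K) => //.
- move=> q r x [Uq Ux xq qx] [Ur _ xr rx].
  case: (ltngtP (pickle q) (pickle r)) => [/(rx q Uq)|/(qx r Ur)|/(pcan_inj pickleK)//].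
    by rewrite ltNge xq.
  by rewrite ltNge xr.
- move=> q; have [Uq|nUq] := pselect (U q); last first.
    by apply: hereditary_B_sub hereditary_B0 => x [].
  case: (Uq) => _ gq; apply: hereditary_B_sub (hereditary_BU WOQ_ideal _ _ gq (hereditary_B1 q)) => x [_ [Px _]].
  by rewrite le_eqVlt => /predU1P[<-|xq] _; [right|left].
move=> S SU wS; have [[x0 Sx0]|S0] := pselect (S !=set0); last first.
  rewrite (_ : [set _ | _] = set0)//; apply/seteqP; split=> // q [x [Sx _]].
  by apply: S0; exists x.
(* With the minimum [m] of [S] in piece [q], every piece enumerated after [q] lies below [q <= m]
   and misses [S]. *)
have [||m Sm mmin] := wS S; [by []|by exists x0|].
have [q [Uq _ qm _]] := cov m (SU _ Sm).
apply/finite_countP; exists (pickle q).+1 => r [x [Sx [_ _ _ rx]]].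
rewrite ltnS leqNgt; apply/negP => /(rx q Uq); rewrite ltNge => /negP; apply.
exact: le_trans qm (mmin x Sx).
Qed.

(** Otherwise each point of [P] has a good side, and [P] is the union of the two hereditary sets
    just built. *)
Let splitting P : bad P -> exists z, [/\ P z, bad (below P z) & bad (above P z)].
Proof.
move=> bP; apply: contrapT => nz; apply: bP.
apply: hereditary_B_sub (hereditary_BU WOQ_ideal _ _ (hereditary_B_below P) (hereditary_B_above P)) => x Px.
have [?|bx] := pselect (hereditary_B WOQ (below P x)); first by left.
have [?|ax] := pselect (hereditary_B WOQ (above P x)); first by right.
by exfalso; apply: nz; exists x.
Qed.

(** The successors of a bad set are bad sets below its point [z], arranged from left to right, so
    well ordered subsets of them have a well ordered union. Along an infinite run the points [z]
    decrease strictly. *)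
Lemma WOQ_borel_hereditary_B A : borel_family (restrict_to WOQ A) -> hereditary_B WOQ A.
Proof.
move=> bI; apply: contrapT => nA.
pose C := {P : set rat | P `<=` A /\ bad P}.
have /(_ _)/cid-/all_sig[z zP] (c : C) := splitting _ (svalP c).2.
have loP (c : C) : below (sval c) (z c) `<=` A /\ bad (below (sval c) (z c)).
  by case: (zP c) => _ bb _; split=> // x [cx _]; apply: (svalP c).1.
have hiP (c : C) : above (sval c) (z c) `<=` A /\ bad (above (sval c) (z c)).
  by case: (zP c) => _ _ ba; split=> // x [cx _]; apply: (svalP c).1.
pose lo c : C := exist _ _ (loP c); pose hi c : C := exist _ _ (hiP c).
(* Repeatedly moving above the splitting point and then taking a lower part yields the increasing
   sequence of successors. *)
pose right_of c n := iter n hi (lo c).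
have right_sub c m n x : (m <= n)%N -> sval (right_of c n) x -> sval (right_of c m) x.
  by move=> mn; rewrite -(subnKC mn); elim: (n - m)%N => [|k IH];
    rewrite ?addn0// addnS => -[/IH].
apply: (@scheme_not_borel _ WOQ A C (exist _ A (conj (@subset_refl _ A) nA)) z sval
  (fun c n => lo (right_of c n)) WOQ_ideal) bI.
- by move=> c; apply: (svalP c).1; case: (zP c).
- by move=> c; case: (zP c).
- by move=> c n x [/(right_sub c 0 n _ (leq0n _)) []].
- move=> c S SE wS B BS [b0 Bb0].
  have SB x : B x -> exists n, (B `&` S n) x.
    by move=> Bx; have [n _ Sx] := BS x Bx; exists n.
  have [|n [x0 [Bx0 Sx0]] nmin] := minimal_pickle (fun n => B `&` S n !=set0).
    by have [n Sn] := SB _ Bb0; exists n, b0.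
  have [||m [Bm Sm] mmin] := wS n (B `&` S n); [by move=> x []|by exists x0|].
  exists m => // x Bx; have [k [_ Sx]] := SB x Bx.
  have /= := nmin k (ex_intro _ x (conj Bx Sx)); rewrite leq_eqVlt => /predU1P[nk|nk].
    by apply: mmin; split=> //; move: Sx; rewrite -(pcan_inj pickleK nk).
  have [_ /= mz] := SE n m Sm.
  have [/(right_sub c n.+1 k _ nk) [_ /= zx] _] := SE k x Sx.
  exact/ltW/(lt_trans mz).
move=> c cn /(_ _ (@subset_refl _ _))[|_ [k _ <-] kmin]; first by exists (z (c 0)), 0.
have [n cE] := cn k; have := kmin (z (c k.+1)) (ex_intro2 _ _ k.+1 Logic.I erefl).
rewrite /= leNgt => /negP; apply.
by have [+ _ _] := zP (c k.+1); rewrite {1}cE => -[/(right_sub _ 0 _ _ (leq0n _)) []].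
Qed.

End WOQ.

(** * Orthogonals of selective ideals *)

Lemma orth_ideal (X : Type) (J : set (set X)) : is_ideal (orth J).
Proof.
by split=> [A|A B|A B]; [apply: orth_fin|apply: orth_sub|apply: orthU].
Qed.

Section Selective.
(** [f] parametrises [J] by the Baire space; [f_cont] says that a finite part of the code guarantees
    membership of a point. *)
Variables (J : set (set nat)) (f : (nat -> nat) -> nat -> bool).
Hypothesis idJ : is_ideal J.
Hypothesis selJ : selective J.
Hypothesis fJ : forall y, J [set i | f y i].
Hypothesis Jf : forall A, J A -> exists y, A = [set i | f y i].
Hypothesis f_cont : forall y i, f y i -> exists n, forall z, agree n y z -> f z i.

Let fI : forall A, finite_set A -> J A. Proof. by case: idJ. Qed.
Let sI : forall A B, A `<=` B -> J B -> J A. Proof. by case: idJ. Qed.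
Let UI : forall A B, J A -> J B -> J (A `|` B). Proof. by case: idJ. Qed.

Let nbr (t : seq nat) (y : nat -> nat) : Prop := mkseq y (size t) = t.

Let decides t i : Prop := forall y, nbr t y -> f y i.

(** For [Q = J] and empty [s]: the trace of [J] on [D] is countably generated. In general only the
    members of [J] coded by extensions of [s] are covered, and [Q] may also be the family of sets
    outside an ultrafilter. *)
Let cov (Q : set (set nat)) s (D : set nat) : Prop :=
  exists2 K : nat -> set nat, (forall n, Q (K n)) &
    forall y, nbr s y -> exists n, [set i | f y i] `&` D `<=` K n.

Let hits Q s D : set nat :=
  [set i | D i /\ exists t, [/\ prefix s t, ~ cov Q t D & decides t i]].

(** If [hits Q s D] were in [Q], it could join the covers of the covered nodes. A code through a
    covered node is handled there; for any other code, every point in [D] is decided by an uncovered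
    segment, hence lies in [hits Q s D]. *)
Let hits_large (Q : set (set nat)) s D : ~ cov Q s D -> ~ Q (hits Q s D).
Proof.
move=> nc QV; apply: nc.
have /(_ _)/cid-/all_sig[K KP] t : exists K : nat -> set nat, cov Q t D ->
    (forall n, Q (K n)) /\
    forall y, nbr t y -> exists n, [set i | f y i] `&` D `<=` K n.
  by have [[K K1 K2]|nc] := pselect (cov Q t D); [exists K|exists (fun=> set0)].
exists (fun m => if unpickle m is Some (Some (t, n)) then
    if `[< cov Q t D >] then K t n else hits Q s D else hits Q s D).
  move=> m; case: unpickle => [[[t n]|]|]//.
  by have [/KP[]|] := asboolP (cov Q t D).
move=> y sy.
have [[k ck]|nk] := pselect (exists k, cov Q (mkseq y k) D).
  have [_ /(_ y)] := KP _ ck; rewrite /nbr size_mkseq => /(_ erefl)[n yn].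
  exists (pickle (Some (mkseq y k, n))); rewrite pickleK.
  by case: asboolP.
exists (pickle (None : option (seq nat * nat))); rewrite pickleK => i [fyi Di].
split=> //; have [n yn] := f_cont y i fyi.
exists (mkseq y (maxn n (size s))); split.
- by rewrite -{1}sy; apply: prefix_mkseq; rewrite leq_maxr.
- by move=> c; apply: nk; exists (maxn n (size s)).
move=> z; rewrite /nbr size_mkseq => /esym/mkseq_agree yz; apply: yn.
by apply: agreeW yz; rewrite leq_maxl.
Qed.

Let not_cov_hit s D m : ~ cov J s D -> exists i t,
  [/\ (m <= i)%N, D i, prefix s t, ~ cov J t D & decides t i].
Proof.
move=> /hits_large nJ; apply: contrapT => ni; apply: nJ.
apply: fI; apply/finite_nat_bounded; exists m => i [Di [t [st nt ti]]].
by rewrite ltnNge; apply/negP => mi; apply: ni; exists i, t.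
Qed.

(* Otherwise the hitting sets along a tree of codes all lie in [p], hence so do
   their finite intersections; selectivity then yields a branch of the tree
   outside [J], although the set coded by that branch belongs to [J]. *)
Let bisequential (p : set_system nat) : UltraFilter p ->
  (forall A, J A -> p (~` A)) -> cov [set K | p (~` K)] [::] setT.
Proof.
move=> pU Jp; set Q := [set K | _]; apply: contrapT => bad0.
pose bad t := ~ cov Q t setT; pose V t := hits Q t setT.
have pV t : bad t -> p (V t).
  move=> /hits_large nV; have [//|pn] := in_ultra_setVsetC (V t) pU.
  by case: nV.
have /(_ _)/cid-/all_sig[nt0 nt0P] (ti : seq nat * nat) : exists t',
    bad ti.1 -> [/\ bad t', prefix ti.1 t' & V ti.1 ti.2 -> decides t' ti.2].
  have [[_ [t [st bt dt]]]|nV] := pselect (V ti.1 ti.2); first by exists t.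
  by exists ti.1; split=> //; apply: prefix_refl.
(* [nt t i] is a bad extension of [t], deciding [i] whenever [i] is in [V t]. *)
pose nt t i := nt0 (t, i).
have ntP t i : bad t -> [/\ bad (nt t i), prefix t (nt t i) & V t i -> decides (nt t i) i].
  exact: (nt0P (t, i)).
pose tt u := foldl nt [::] u.
have bad_tt u : bad (tt u).
  elim/last_ind: u => [//|u i IH]; rewrite /tt foldl_rcons.
  by case: (ntP (tt u) i IH).
(* [Ls n] lists the increasing sequences of numbers below [n]; as it is finite, [An n] is a finite
   intersection of sets in [p]. *)
pose Ls := fix Ls n := if n is k.+1 then Ls k ++ [seq rcons u k | u <- Ls k] else [:: [::]].
pose An n := [set i | forall u, u \in Ls n.+1 -> V (tt u) i].
have pAn n : p (An n).
  rewrite /An; elim: (Ls n.+1) => [|u l IH]; first by apply: filterS filterT.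
  apply: filterS (filterI (pV _ (bad_tt u)) IH) => i [ui li] v.
  by rewrite inE => /predU1P[->//|/li].
have JpF A : J A -> p A -> False.
  move=> /Jp pnA pA; apply: (@filter_not_empty _ p _).
  by apply: filterS (filterI pnA pA) => x [].
have AnS n : An n.+1 `<=` An n.
  by move=> i Ai u ul; apply: Ai; rewrite /= mem_cat ul.
have [B nJB BA] := selJ An AnS (fun n JA => JpF _ JA (pAn n)).
pose us k := [seq i <- iota 0 k | `[< B i >]].
have usS k : us k.+1 = if `[< B k >] then rcons (us k) k else us k.
  by rewrite /us -addn1 iotaD filter_cat /= add0n; case: asboolP; rewrite ?cats1 ?cats0.
have usL k : us k \in Ls k.
  elim: k => [//|k IH]; rewrite usS /= mem_cat; case: asboolP => _; last by rewrite IH.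
  by rewrite (map_f (rcons^~ k) IH) orbT.
have [|b bP] := chain_limit (fun k => tt (us k)).
  move=> k; rewrite usS; case: asboolP => _; last exact: prefix_refl.
  by rewrite /tt foldl_rcons; case: (ntP (tt (us k)) k (bad_tt _)).
have last_us i n0 : (n0 < i)%N -> B n0 ->
    exists2 n, B n & (n < i)%N /\ us i = us n.+1.
  move=> ni Bn0; elim: i ni => // i IH; rewrite ltnS => ni.
  have [Bi|nBi] := pselect (B i); first by exists i.
  move: ni; rewrite leq_eqVlt => /predU1P[n0i|/IH[n Bn [ni usi]]].
    by rewrite n0i in Bn0.
  by exists n => //; split; [apply: ltnW|rewrite usS; case: asboolP].
have [i0 Bi0] : B !=set0.
  by apply/set0P/eqP => B0; apply: nJB; rewrite B0; apply: fI.
(* Past [i0], each [i] in [B] has a predecessor [n] in [B]. Then [us i] is in [Ls n.+1], selectivity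
   puts [i] in [An n], and the branch decides [i]. So a finite set and the set coded by [b] cover
   [B]. *)
apply: nJB; apply: sI (UI _ _ (fI [set i | (i <= i0)%N] _) (fJ b)).
  move=> i Bi; have [|i0i] := leqP i i0; [by left|right].
  have [n Bn [ni usE]] := last_us i i0 i0i Bi0.
  have Vi : V (tt (us i)) i.
    have := BA n Bn i; apply; last by rewrite usE; apply: usL.
    by split=> //=; apply/negP; rewrite -ltnNge.
  have [_ _ /(_ Vi)] := ntP (tt (us i)) i (bad_tt _); apply.
  have := bP i.+1; rewrite usS; case: asboolP => // _.
  by rewrite /tt foldl_rcons.
by apply/finite_nat_bounded; exists i0.+1.
Qed.

Let cov_sub s D E : D `<=` E -> cov J s E -> cov J s D.
Proof.
move=> DE [K KJ KE]; exists K => // y /KE[n yn]; exists n => i [yi /DE Ei].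
exact: yn.
Qed.

Let covU s D E : cov J s D -> cov J s E -> cov J s (D `|` E).
Proof.
move=> [K KJ KD] [L LJ LE].
exists (fun m => if unpickle m is Some (k, l) then K k `|` L l else set0).
  by move=> m; case: unpickle => [[k l]|]; [apply: UI|apply: fI].
move=> y sy; have [k yk] := KD y sy; have [l yl] := LE y sy.
exists (pickle (k, l)); rewrite pickleK => i [yi [Di|Ei]]; first by left; apply: yk.
by right; apply: yl.
Qed.

(** An ultrafilter extending the sets with covered complement in [D] is disjoint from [J], so
    [bisequential] gives sets [K n] outside it that absorb all members of [J]. Removing the first of
    them from [D] leaves uncovered sets, and a member of [J] misses almost all of these. *)
Let converging s D : ~ cov J s D -> exists D' : nat -> set nat,
  [/\ forall n, D' n `<=` D, forall n, ~ cov J s (D' n) &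
      forall a, J a -> exists m, forall n, (m <= n)%N -> a `&` D' n = set0].
Proof.
move=> ncD; pose G : set_system nat := [set E | cov J s (D `\` E)].
have cov0 : cov J s set0.
  by exists (fun=> set0) => [_|y _]; [apply: fI|exists 0 => i []].
have GG : ProperFilter G.
  split.
    by move=> c0; apply: ncD; apply: cov_sub c0 => x Dx; split.
  split.
  - by rewrite /G /= setDT.
  - move=> E E' cE cE'; apply: cov_sub (covU _ _ _ cE cE') => x [Dx nE].
    by have [Ex|nEx] := pselect (E x); [right|left]; split=> // E'x; apply: nE.
  - by move=> E E' EE'; apply: cov_sub => x [Dx nE]; split=> // /EE'.
have [p [pU Gp]] := ultraFilterLemma GG.
have [|K pK Kc] := bisequential p pU.
  move=> A JA; apply: Gp; exists (fun=> A) => // y _; exists 0 => i [_ [_]].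
  exact: contrapT.
pose E n := [set i | forall k, (k <= n)%N -> ~ K k i].
have {}pK n : p (~` K n) := pK n.
have pE n : p (E n).
  elim: n => [|n IH].
    by apply: filterS (pK 0) => i nK k; rewrite leqn0 => /eqP->.
  apply: filterS (filterI (pK n.+1) IH) => i [nK Ei] k.
  by rewrite leq_eqVlt => /predU1P[->//|]; rewrite ltnS; apply: Ei.
exists (fun n => D `&` E n); split=> [n x []//|n cn|a].
  have /Gp pnE : G (~` E n) by apply: cov_sub cn => x [Dx /contrapT].
  apply: (@filter_not_empty _ p _); apply: filterS (filterI pnE (pE n)) => x [].
  by [].
move=> /Jf[y ->]; have [|m ym] := Kc y; first by [].
exists m => n mn; apply/seteqP; split=> // i [yi [_ Ei]].
by apply: (Ei m mn); apply: ym.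
Qed.

(** A configuration is a node uncovered on a domain, with a point of the domain decided by the node.
    Successor domains come from [converging], so a member of [J] meets finitely many of them; the
    points of an infinite run increase and all lie in the member of [J] coded by the limit of the
    nodes. *)
Lemma borel_cov A : borel_family (restrict_to (orth J) A) -> cov J [::] A.
Proof.
move=> bI; apply: contrapT => ncA.
pose C := {c : seq nat * set nat * nat | [/\ ~ cov J c.1.1 c.1.2,
  c.1.2 `<=` A, c.1.2 c.2 & decides c.1.1 c.2]}.
pose st (c : C) := (sval c).1.1; pose dom (c : C) := (sval c).1.2.
pose pt (c : C) := (sval c).2.
have [i0 [t0 [_ Ai0 _ nc0 dt0]]] := not_cov_hit _ _ 0 ncA.
pose c0 : C := exist _ (t0, A, i0) (And4 nc0 (@subset_refl _ A) Ai0 dt0).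
have /(_ _)/cid-/all_sig[next nextP] (c : C) : exists nx : nat -> C,
    (forall n, [/\ dom (nx n) `<=` dom c, prefix (st c) (st (nx n)) & (pt c < pt (nx n))%N]) /\
    forall a, J a -> exists m, forall n, (m <= n)%N -> a `&` dom (nx n) = set0.
  case: c => [[[s D] i] [/= ncD DA Di si]].
  have [D' [D'D ncD' Da]] := converging _ _ ncD.
  have /(_ _)/cid-/all_sig[g gP] n : exists c : C,
      [/\ dom c = D' n, prefix s (st c) & (i < pt c)%N].
    have [j [t [ij Dj sj nct tj]]] := not_cov_hit _ _ i.+1 (ncD' n).
    by exists (exist _ (t, D' n, j) (And4 nct (subset_trans (D'D n) DA) Dj tj)).
  exists g; split=> [n|a /Da[m mP]]; first by have [-> ? ?] := gP n.
  by exists m => n /mP; have [-> _ _] := gP n.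
apply: (@scheme_not_borel _ (orth J) A C c0 pt dom next (orth_ideal _ J)) bI.
- by move=> c; case: (svalP c) => _ cA cc _; apply: cA.
- by move=> c; case: (svalP c).
- by move=> c n; case: (nextP c) => /(_ n)[].
- move=> c S SE oS a Ja; have [_ /(_ a Ja)[m mP]] := nextP c.
  apply: (sub_finite_set (B := \bigcup_(n in `I_m) (a `&` S n))).
    move=> x [ax [n _ Sx]]; exists n => //=; rewrite ltnNge; apply/negP => /mP a0.
    by have : (a `&` dom (next c n)) x; [split=> //; apply: SE Sx|rewrite a0].
  by apply: bigcup_finite => [|n _]; [apply: finite_II|apply: oS].
move=> c cn oc.
have cS k : prefix (st (c k)) (st (c k.+1)) /\ (pt (c k) < pt (c k.+1))%N.
  by have [n ->] := cn k; case: (nextP (c k)) => /(_ n)[].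
have [|b bP] := chain_limit (fun k => st (c k)); first by move=> k; case: (cS k).
have /finite_nat_bounded[m mP] := oc _ (fJ b).
have ptm : (m <= pt (c m))%N.
  by elim: (m) => // k IH; apply: leq_ltn_trans IH _; case: (cS k).
suff : (pt (c m) < m)%N by rewrite ltnNge ptm.
apply: mP; split; last by exists m.
by case: (svalP (c m)) => _ _ _; apply; apply: bP.
Qed.

(** Sort points by the first [K n] containing them. As [K n] is in [J], the orthogonal is the ideal
    of finite sets on such a piece; the points outside all [K n] form a set in the orthogonal. The
    whole is their direct sum. *)
Lemma cov_hereditary_B A : cov J [::] A -> hereditary_B (orth J) A.
Proof.
move=> [K KJ KA].
have aK a : J a -> exists n, a `&` A `<=` K n.
  by move=> /Jf[y ->]; apply: KA.
pose L o := if o is Some n then [set i | [/\ A i, K n i & forall m, (m < n)%N -> ~ K m i]]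
  else [set i | A i /\ forall m, ~ K m i].
apply: (hereditary_B_sum (orth_ideal _ J) L).
- move=> [m|] [n|] i //=.
  + move=> [_ Km nm] [_ Kn nn]; case: (ltngtP m n) => [/nn//|/nm//|->//].
  + by move=> [_ Km _] [_ /(_ m)].
  + by move=> [_ nK] [_ /nK].
- move=> i Ai; have [eK|nK] := pselect (exists n, K n i); last first.
    by exists None; split=> // m Km; apply: nK; exists m.
  have [n Kn nmin] := minimal_pickle (fun n => K n i) eK.
  exists (Some n); split=> // m mn Km; have := nmin m Km; rewrite leqNgt.
  by move=> /negP; apply.
- move=> [n|]; last first.
    apply: (hereditary_B_mem (orth_ideal _ J)) => a /aK[n an].
    by rewrite (_ : _ `&` _ = set0)//; apply/seteqP; split=> // i [ai [Ai /(_ n)]]; apply; apply: an.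
  move=> B BL; have [|infB] := pselect (finite_set B); [by left|right].
  apply: (B_copy_finite (orth_ideal _ J)) => // S SB /(_ _ (KJ n)).
  by apply: sub_finite_set => i Si; split=> //; have [] := BL i (SB i Si).
move=> S SA oS a /[dup] Ja /aK[n an].
(* A member of [J] contained in [K n] on [A] meets only the pieces of index at most [n]. *)
apply: (sub_finite_set (B := \bigcup_(m in `I_n.+1) (K m `&` (S `&` L (Some m))))).
  move=> i [ai Si]; have Kn : K n i by apply: an; split=> //; apply: SA.
  have [m Km mmin] := minimal_pickle (fun n => K n i) (ex_intro _ n Kn).
  exists m; first by rewrite /= ltnS; apply: mmin.
  split=> //; split=> //; split=> //; first exact: SA.
  by move=> k km Kk; have := mmin k Kk; rewrite leqNgt => /negP; apply.
by apply: bigcup_finite => [|m _]; [apply: finite_II|apply: (oS (Some m))].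
Qed.

End Selective.

(** Membership of [i] is an open condition, so continuity reduces it to finitely many entries of the
    code; [J set0] rules out the empty family. *)
Lemma analytic_code (J : set (set nat)) : J set0 -> analytic_family J ->
  exists f : (nat -> nat) -> nat -> bool,
  [/\ forall y, J [set i | f y i], forall A, J A -> exists y, A = [set i | f y i]
    & forall y i, f y i -> exists n, forall z, agree n y z -> f z i].
Proof.
move=> J0 [E0|[f fcont fE]].
  have : char_set J (fun=> false).
    by rewrite /char_set /=; move: J0; congr J; apply/seteqP; split.
  by rewrite E0.
exists f; split=> [y|A JA|y i fyi].
- by have : char_set J (f y) by rewrite -fE; exists y.
- have : char_set J (fun i => `[< A i >]).
    by move: JA; congr J; apply/seteqP; split=> i /= => /asboolP.
  rewrite -fE => -[y _ yE]; exists y.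
  by apply/seteqP; split=> i /=; rewrite yE => /asboolP.
have nb : nbhs (f y) [set c : two_pow nat | c i].
  apply: (@proj_continuous nat (fun=> bool) i (f y) [set b : bool | b]).
  by apply: open_nbhs_nbhs; split=> //; apply: discrete_open.
have [s sP] := prod_discrete_nbhs _ _ (fcont y _ nb).
exists (\max_(k <- s) k).+1 => z yz; apply: sP => k ks; rewrite yz// ltnS.
exact: (leq_bigmax_seq (F := id)).
Qed.

Theorem mainTheorem3 :
  [/\ forall A : set (seq nat), infinite_set A ->
        (iso_in_B (restrict_to Iwf A) <-> borel_family (restrict_to Iwf A)),
      forall A : set rat, infinite_set A ->
        (iso_in_B (restrict_to WOQ A) <-> borel_family (restrict_to WOQ A))
    & forall J : set (set nat),
        is_ideal J -> selective J -> analytic_family J ->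
        forall A : set nat, infinite_set A ->
          (iso_in_B (restrict_to (orth J) A) <->
           borel_family (restrict_to (orth J) A))].
Proof.
split=> [A infA|A infA|J idJ selJ anJ A infA]; split; try exact: iso_in_B_borel.
- by move=> /Iwf_borel_hereditary_B gA; apply: hereditary_B_iso.
- by move=> /WOQ_borel_hereditary_B gA; apply: hereditary_B_iso.
have [fJ0 _ _] := idJ.
have [f [fJ Jf f_cont]] := analytic_code J (fJ0 _ (finite_set0 _)) anJ.
move=> bA; apply: hereditary_B_iso infA.
apply: (cov_hereditary_B _ _ Jf); exact: borel_cov idJ selJ fJ Jf f_cont _ bA.
Qed.
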